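(* Let $w_0,w_1\in\mathbf W_n$. If $r>r_\bullet(n)$ and $\mathcal L_n^{[H^r]}[w_1]\cap\overline{\mathcal L_n^{[H^r]}[w_0]}\neq\emptyset$, then $\mathrm{mult}(w_0)\le\mathrm{mult}(w_1)$.
   Context: Fix an integer $n\ge2$. $\Pi:\mathrm{Spin}_{n+1}\to\mathrm{SO}_{n+1}$ is the universal (double) cover; Lie algebras are identified via $\Pi$. For $1\le j\le n$ let $\mathfrak a_j=e_{j+1}e_j^\top-e_je_{j+1}^\top$. A map $\Gamma:J\to\mathrm{Spin}_{n+1}$ on an interval is locally convex if it is absolutely continuous and a.e. $\Gamma^{-1}\Gamma'=\sum_j\kappa_j\mathfrak a_j$ with positive functions $\kappa_j$. Permutations act on the right ($i\mapsto i^\sigma$); $P_\sigma$ is the matrix with ones at positions $(i,i^\sigma)$; $\eta:i\mapsto n+2-i$. $\mathrm{Bru}_\sigma\subset\mathrm{Spin}_{n+1}$ is the set of $z$ such that $\Pi(z)=U_0P_\sigma U_1$ with $U_0,U_1$ invertible upper triangular; $\mathrm{Spin}_{n+1}$ is the disjoint union of the $\mathrm{Bru}_\sigma$, and $\mathrm{Bru}_\eta$ is open and dense. $\mathrm{Quat}_{n+1}=\Pi^{-1}[\{\text{diagonal matrices in }\mathrm{SO}_{n+1}\}]$. For an integer $r\ge2$, $\mathcal L_n^{[H^r]}(q)$ is the space of locally convex curves $\Gamma:[0,1]\to\mathrm{Spin}_{n+1}$, $\Gamma(0)=1$, $\Gamma(1)=q$, of Sobolev class $H^r=W^{r,2}$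 (all $\kappa_j>0$ everywhere), with the $H^r$ topology; $\mathcal L_n^{[H^r]}=\bigsqcup_{q\in\mathrm{Quat}_{n+1}}\mathcal L_n^{[H^r]}(q)$; closures are taken in this space. $\mathrm{Sing}_{n+1}=\mathrm{Spin}_{n+1}\smallsetminus\mathrm{Bru}_\eta$; for $\Gamma:[t_0,t_1]\to\mathrm{Spin}_{n+1}$ locally convex, $\mathrm{sing}(\Gamma)=\Gamma^{-1}[\mathrm{Sing}_{n+1}]\smallsetminus\{t_0,t_1\}$, a finite set $\{\tau_1<\dots<\tau_\ell\}$; for each $j$ let $\sigma_j\in S_{n+1}\smallsetminus\{e\}$ be such that $\Gamma(\tau_j)\in\mathrm{Bru}_{\eta\sigma_j}$; the itinerary is $\mathrm{iti}(\Gamma)=(\sigma_1,\dots,\sigma_\ell)$. $\mathbf W_n$ is the set of finite words (including the empty word) in the alphabet $S_{n+1}\smallsetminus\{e\}$; $\mathcal L_n^{[H^r]}[w]=\{\Gamma\in\mathcal L_n^{[H^r]}:\mathrm{iti}(\Gamma)=w\}$. For $\sigma\in S_{n+1}$ and $1\le j\le n$, $\mathrm{mult}_j(\sigma)=(1^\sigma+\cdots+j^\sigma)-(1+\cdots+j)\in\mathbb N$ and $\mathrm{mult}(\sigma)=(\mathrm{mult}_1(\sigma),\dots,\mathrm{mult}_n(\sigma))\in\mathbb N^n$. For $w=(\sigma_1,\dots,\sigma_\ell)\in\mathbf W_n$, $\mathrm{mult}(w)=\sum_i\mathrm{mult}(\sigma_i)$. For $u,v\in\mathbb N^n$, $u\le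 v$ means $u_j\le v_j$ for all $j$. Finally $r_\bullet(n)=\left\lfloor\left(\frac{n+1}{2}\right)^2\right\rfloor=\max\{\mathrm{mult}_j(\sigma):\sigma\in S_{n+1},1\le j\le n\}$. *)

(* Defs.v *)
From HB Require Import structures.
From mathcomp Require Import all_boot all_order all_fingroup all_algebra.
From mathcomp Require Import all_classical all_reals all_analysis.

Set Implicit Arguments.
Unset Strict Implicit.
Unset Printing Implicit Defensive.

Import Order.TTheory GRing.Theory Num.Theory.
Import numFieldNormedType.Exports.

Local Open Scope classical_set_scope.
Local Open Scope ring_scope.

(* The real Clifford algebra on m generators with e_i ^ 2 = -1, in the basis
   e_A = e_{a_1} ... e_{a_k} (A = {a_1 < ... < a_k}).  Moving the generators of
   e_A e_B into increasing order costs a sign for every pair (a, b) with a > b,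
   and e_a e_a = -1 costs one for every pair with a = b. *)
Definition clifford (R : realType) (m : nat) : Type := {ffun {set 'I_m} -> R}.

Definition cl_sign (R : realType) (m : nat) (A B : {set 'I_m}) : R :=
  (-1) ^+ #|[pred p : 'I_m * 'I_m | [&& p.1 \in A, p.2 \in B & (p.2 <= p.1)%N]]|.

Definition cl_mul (R : realType) (m : nat) (x y : clifford R m) :
    clifford R m :=
  [ffun C : {set 'I_m} =>
    \sum_(A : {set 'I_m}) \sum_(B : {set 'I_m} | (A :\: B) :|: (B :\: A) == C)
      cl_sign R A B * x A * y B].

Definition cl_one (R : realType) (m : nat) : clifford R m :=
  [ffun A : {set 'I_m} => (A == finset.set0)%:R].

Definition cl_vec (R : realType) (m : nat) (v : 'rV[R]_m) : clifford R m :=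
  [ffun A : {set 'I_m} => \sum_(i < m | A == [set i]%SET) v ord0 i].

(* The anti-automorphism extending v |-> - v on vectors; it inverts products of
   unit vectors. *)
Definition cl_conj (R : realType) (m : nat) (x : clifford R m) : clifford R m :=
  [ffun A : {set 'I_m} => (-1) ^+ 'C(#|A|.+1, 2) * x A].

(* Spin_m: products of an even number of unit vectors. *)
Definition Spin (R : realType) (m : nat) : set (clifford R m) :=
  [set z | exists s : seq 'rV[R]_m,
     [/\ ~~ odd (size s),
         forall v, v \in s -> \sum_(i < m) v ord0 i ^+ 2 = 1
       & z = foldr (@cl_mul R m) (cl_one R m) [seq cl_vec v | v <- s]]].

(* The double cover Spin_m -> SO_m: the matrix of v |-> z v z^-1, so that
   column j holds the coordinates of the image of e_j. *)
Definition Pi (R : realType) (m : nat) (z : clifford R m) : 'M[R]_m :=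
  \matrix_(i < m, j < m)
    cl_mul (cl_mul z (cl_vec (delta_mx ord0 j))) (cl_conj z) [set i]%SET.

Definition upper_triangular (R : realType) (m : nat) (U : 'M[R]_m) : bool :=
  is_trig_mx U^T.

(* [perm_mx sigma] has its ones at the positions (i, sigma i), and
   [(sigma * tau) i = tau (sigma i)], i.e. permutations act on the right. *)
Definition Bru (R : realType) (n : nat) (sigma : 'S_n.+1) :
    set (clifford R n.+1) :=
  [set z | Spin z /\
     exists U0 U1 : 'M[R]_n.+1,
       [/\ upper_triangular U0, U0 \in unitmx,
           upper_triangular U1, U1 \in unitmx
         & Pi z = U0 *m perm_mx sigma *m U1]].

Definition eta (n : nat) : 'S_n.+1 := perm (@rev_ord_inj n.+1).

Definition Sing (R : realType) (n : nat) : set (clifford R n.+1) :=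
  @Spin R n.+1 `\` Bru (eta n).

Definition Quat (R : realType) (n : nat) : set (clifford R n.+1) :=
  [set z | Spin z /\ is_diag_mx (Pi z)].

Definition frak_a (R : realType) (n : nat) (j : 'I_n) : 'M[R]_n.+1 :=
  delta_mx (lift ord0 j) (widen_ord (leqnSn n) j)
  - delta_mx (widen_ord (leqnSn n) j) (lift ord0 j).

(* Curves [0, 1] -> Spin are represented by functions on R of which only the
   values on [0, 1] matter. *)

(* d is the derivative at t of f restricted to [0, 1] (one-sided at 0 and 1). *)
Definition deriv01 (R : realType) (f : R -> R) (t d : R) : Prop :=
  (f s - f t) / (s - t) @[s --> within `[0, 1] t^'] --> d.

Definition abs_continuous01 (R : realType) (f : R -> R) : Prop :=
  forall e : R, 0 < e -> exists2 d : R, 0 < d &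
    forall (N : nat) (a b : 'I_N -> R),
      (forall i, 0 <= a i /\ a i <= b i /\ b i <= 1) ->
      (forall i j, i != j -> b i <= a j \/ b j <= a i) ->
      \sum_(i < N) (b i - a i) < d ->
      \sum_(i < N) `|f (b i) - f (a i)| < e.

(* Gamma^-1 Gamma' = \sum_j kappa_j a_j at time t, with all kappa_j > 0.  As Pi
   is a homomorphism, the element of so_(n+1) that it identifies with
   Gamma^-1 Gamma' is (Pi o Gamma)^-1 (Pi o Gamma)'. *)
Definition convex_at (R : realType) (n : nat) (Gamma : R -> clifford R n.+1)
    (t : R) : Prop :=
  exists kappa : 'I_n -> R,
    (forall j, 0 < kappa j) /\
    forall i k, deriv01 (fun s => Pi (Gamma s) i k) t
      ((Pi (Gamma t) *m \sum_(j < n) kappa j *: frak_a R j) i k).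

Definition locally_convex_curve (R : realType) (n : nat)
    (Gamma : R -> clifford R n.+1) : Prop :=
  [/\ forall t, `[0, 1]%classic t -> Spin (Gamma t),
      forall A, abs_continuous01 (fun t => Gamma t A)
    & {ae @lebesgue_measure R,
         forall t, `[0, 1]%classic t -> convex_at Gamma t}].

(* W^{r,2}(]0, 1[), with weak derivatives tested against C^1 functions with
   compact support in ]0, 1[, as in Brezis, Functional Analysis, Sobolev Spaces
   and Partial Differential Equations, section 8.2. *)
Definition test_fun (R : realType) (phi : R -> R) : Prop :=
  [/\ forall x, derivable phi x 1,
      continuous (derive1 phi)
    & exists a b : R, [/\ 0 < a, b < 1 &
        forall x, ~ `[a, b]%classic x -> phi x = 0]].

Definition is_weak_deriv (R : realType) (u g : R -> R) : Prop :=
  forall phi : R -> R, test_fun phi ->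
    \int[@lebesgue_measure R]_(x in `]0, 1[) (u x * derive1 phi x) =
    - \int[@lebesgue_measure R]_(x in `]0, 1[) (g x * phi x).

Definition square_integrable (R : realType) (f : R -> R) : Prop :=
  measurable_fun (`]0, 1[%classic : set R) f /\
  (@lebesgue_measure R).-integrable `]0, 1[ (fun x => (f x ^+ 2)%:E).

(* g 0, ..., g r are the successive weak derivatives of f. *)
Definition weak_derivs (R : realType) (r : nat) (f : R -> R)
    (g : nat -> R -> R) : Prop :=
  [/\ forall x, `]0, 1[%classic x -> g 0 x = f x,
      forall k, (k <= r)%N -> square_integrable (g k)
    & forall k, (k < r)%N -> is_weak_deriv (g k) (g k.+1)].

Definition sobolev (R : realType) (r : nat) (f : R -> R) : Prop :=
  exists g, weak_derivs r f g.

(* The W^{r,2} norm of f is smaller than e. *)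
Definition sobolev_norm_lt (R : realType) (r : nat) (f : R -> R) (e : R) :
    Prop :=
  exists2 g, weak_derivs r f g &
    (\sum_(k < r.+1)
       \int[@lebesgue_measure R]_(x in `]0%R, 1%R[) (g k x ^+ 2)%:E
     < (e ^+ 2)%:E)%E.

Definition calL_at (R : realType) (n r : nat) (q : clifford R n.+1) :
    set (R -> clifford R n.+1) :=
  [set Gamma |
    [/\ locally_convex_curve Gamma,
        Gamma 0 = cl_one R n.+1, Gamma 1 = q,
        forall A, sobolev r (fun t => Gamma t A)
      & forall t, `[0, 1]%classic t -> convex_at Gamma t]].

Definition calL (R : realType) (n r : nat) : set (R -> clifford R n.+1) :=
  \bigcup_(q in @Quat R n) calL_at r q.

(* Closure, within [calL R n r], for the metric topology of the W^{r,2} distance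
   between curves in the finite-dimensional space [clifford R n.+1]. *)
Definition Hr_closure (R : realType) (n r : nat)
    (S : set (R -> clifford R n.+1)) : set (R -> clifford R n.+1) :=
  [set Gamma | @calL R n r Gamma /\
    forall e : R, 0 < e -> exists2 Delta, S Delta &
      forall A, sobolev_norm_lt r (fun t => Delta t A - Gamma t A) e].

Definition is_word (n : nat) (w : seq 'S_n.+1) : bool :=
  all (fun sigma => sigma != 1%g) w.

Definition sing (R : realType) (n : nat) (Gamma : R -> clifford R n.+1) :
    set R :=
  [set t | 0 < t < 1 /\ Sing (Gamma t)].

(* iti(Gamma) = w, where tau enumerates sing(Gamma) increasingly. *)
Definition itinerary (R : realType) (n : nat) (Gamma : R -> clifford R n.+1)
    (w : seq 'S_n.+1) : Prop :=
  exists tau : seq R,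
    [/\ sorted <%R tau,
        forall t, sing Gamma t <-> t \in tau,
        size tau = size w
      & forall i, (i < size w)%N ->
          nth 1%g w i != 1%g /\
          Bru (eta n * nth 1%g w i)%g (Gamma (nth 0 tau i))].

Definition calL_iti (R : realType) (n r : nat) (w : seq 'S_n.+1) :
    set (R -> clifford R n.+1) :=
  [set Gamma | @calL R n r Gamma /\ itinerary Gamma w].

(* Indices start at 0 here, which shifts both sums by the same amount; the
   subtraction in nat does not truncate, since the j + 1 distinct numbers
   sigma 0, ..., sigma j sum up to at least 0 + ... + j. *)
Definition mult (n : nat) (sigma : 'S_n.+1) (j : 'I_n) : nat :=
  (\sum_(i < n.+1 | i <= j) sigma i - \sum_(i < n.+1 | i <= j) i)%N.

Definition mult_word (n : nat) (w : seq 'S_n.+1) (j : 'I_n) : nat :=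
  (\sum_(sigma <- w) mult sigma j)%N.

(* floor(((n + 1) / 2) ^ 2) *)
Definition r_bullet (n : nat) : nat := (n.+1 ^ 2 %/ 4)%N.

(* Main.v *)
(* Let m_j be the j-th southwest minor of the matrix Q = Pi o Gamma.  If Gamma(tau)
   lies in Bru_(eta sigma), then m_j vanishes at tau to order exactly mult_j(sigma):
   writing Q(tau) = U0 P U1 with P the permutation matrix of eta sigma, the frame
   X = (U0 P)^-1 Q solves X' = X Lambda with X(tau) = U1, so that its entries satisfy
   X_lc(t) ~ const (t - tau)^(l - c) below the diagonal, and the determinant of
   leading coefficients is a Vandermonde determinant up to nonzero factors.  Hence
   mult_j of the itinerary counts the zeros of m_j in ]0, 1[ with multiplicity.
   Convergence in H^r implies convergence in C^(r-1), and r - 1 is at least every order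
   of vanishing, so by Rolle's theorem a curve close to Gamma has, near each t, at most
   as many zeros of m_j as the order of vanishing of m_j at t for Gamma.  At t = 0 and
   t = 1 the order is mult_j(eta) for every curve, and these two terms cancel. *)

Require Import Defs.
From mathcomp Require Import all_boot all_order all_fingroup all_algebra.
From mathcomp Require Import all_classical all_reals all_analysis.
From mathcomp Require Import measurable_realfun ring lra.

Set Implicit Arguments.
Unset Strict Implicit.
Unset Printing Implicit Defensive.

Import Order.TTheory GRing.Theory Num.Theory.
Import numFieldNormedType.Exports.

Local Open Scope classical_set_scope.
Local Open Scope ring_scope.

(** * Test functions and Lebesgue points *)

(** Curves are arbitrary outside [0, 1], and [convex_at] gives only one-sided derivatives at the
    ends, while the calculus used here is two-sided. Each curve is therefore replaced by a function
    that agrees with it on [0, 1] and has two-sided derivatives there. The weak derivatives supply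
    it: testing them against smoothed indicators of intervals shows that increments are integrals of
    the weak derivative, so that each weak derivative below the top one has a continuous
    representative. Orders of vanishing are expressed by leading terms ([asymp]), because those of a
    determinant follow from those of its entries, and the entries need only one derivative of Pi o
    Gamma and continuous kappa_j. Higher derivatives enter only with Rolle's theorem; [asymp_derivs]
    translates. The bound near t rests on a derivative that is nonzero at t for the limit, hence
    near t for all close curves; compactness of [0, 1] makes one threshold serve all t. The ends are
    counted because zeros in ]0, 1[ of the approximating curves might tend to an end; as the end
    itself already takes up the whole order allowed there, none can. *)

Definition hinge (R : realType) (t : R) : R := (t * t + t * `|t|) / 4.
Definition hinge' (R : realType) (t : R) : R := (t + `|t|) / 2.

Lemma is_derive_hinge (R : realType) (t : R) :
  is_derive t 1 (@hinge R) (hinge' t).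
Proof.
have der_pos : forall u : R, 0 < u -> is_derive u 1 (@hinge R) u.
  move=> u u0.
  apply: (@near_eq_is_derive _ _ _ (fun v : R => v * v / 2)).
    near=> v; rewrite /hinge ger0_norm; first by field.
    by apply: ltW; near: v; exact: lt_nbhsr.
  by apply: is_derive_eq; rewrite /GRing.scale /=; field.
have der_neg : forall u : R, u < 0 -> is_derive u 1 (@hinge R) 0.
  move=> u u0.
  apply: (@near_eq_is_derive _ _ _ (cst 0)).
    near=> v; rewrite /hinge /= ler0_norm; first by field.
    by apply: ltW; near: v; exact: lt_nbhsl.
have [t0|t0|t0] := ltrgtP t 0.
- have -> : hinge' t = 0 by rewrite /hinge' ltr0_norm// subrr mul0r.
  exact: der_neg.
- have -> : hinge' t = t by rewrite /hinge' gtr0_norm//; field.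
  exact: der_pos.
- have -> : hinge' t = 0 by rewrite /hinge' t0 normr0 addr0 mul0r.
  subst t.
  have lim0 : (fun h : R => h^-1 *: (hinge (h *: 1 + 0) - hinge 0)) @ 0^' --> (0 : R).
    apply/cvgrPdist_lt => e e0; near=> h.
    rewrite /hinge /GRing.scale /= sub0r normrN addr0 !mulr1 !mul0r addr0 mul0r subr0.
    have h0 : h != 0 by near: h; exact: nbhs_dnbhs_neq.
    have -> : h^-1 * ((h * h + h * `|h|) / 4) = (h + `|h|) / 4 by field.
    have he : `|h| < e.
      near: h; apply: dnbhs0_lt => //.
    rewrite normrM [X in _ * X]ger0_norm ?invr_ge0//.
    have := ler_normD h `|h|; rewrite normr_id; lra.
  split; last exact: cvg_lim lim0.
  by apply/cvg_ex; exists 0.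
Unshelve. all: by end_near.
Qed.

(* As hinge is C^1, step x e is a C^1 transition from 0 to 1 across [x - e, x + e],
   with the tent kernel as its derivative. *)
Definition step (R : realType) (x e t : R) : R :=
  (hinge (t - x + e) - hinge (t - x) - hinge (t - x) + hinge (t - x - e))
    / e ^+ 2.
Definition tent (R : realType) (x e t : R) : R :=
  (hinge' (t - x + e) - hinge' (t - x) - hinge' (t - x) + hinge' (t - x - e))
    / e ^+ 2.

Lemma is_derive_step (R : realType) (x e t : R) :
  is_derive t 1 (step x e) (tent x e t).
Proof.
have H (c : R) : is_derive t 1 (fun v => hinge (v - x + c)) (hinge' (t - x + c)).
  have D : is_derive (t - x + c) 1 (@hinge R) (hinge' (t - x + c)) := is_derive_hinge _.
  rewrite -[X in is_derive _ _ _ X]mulr1.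
  apply: (is_derive1_comp (f := @hinge R) (g := fun v => v - x + c)) => //.
  by apply: is_derive_eq; rewrite subr0 addr0.
have H1 := H e; have H2 := H (- e).
have H0 : is_derive t 1 (fun v => hinge (v - x)) (hinge' (t - x)).
  by have := H 0; under eq_fun do rewrite addr0; rewrite addr0.
rewrite /step /tent.
by apply: is_derive_eq; rewrite /GRing.scale /= mulr0 add0r mulrC.
Qed.

Lemma hinge'E (R : realType) (t : R) : hinge' t = Num.max t 0.
Proof.
rewrite /hinge'; case: (lerP 0 t) => t0.
  by rewrite ger0_norm//; field.
by rewrite ltr0_norm// subrr mul0r.
Qed.

Lemma hingeE (R : realType) (t : R) : hinge t = (Num.max t 0) ^+ 2 / 2.
Proof.
rewrite /hinge; case: (lerP 0 t) => t0.
  by rewrite ger0_norm//; field.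
by rewrite ltr0_norm// mulrN subrr mul0r expr0n mul0r.
Qed.

Lemma tent_cont (R : realType) (x e : R) : continuous (tent x e).
Proof.
move=> t; rewrite /tent /hinge'.
have C (c : R) : {for t, continuous (fun v : R => v - x + c)}.
  apply: cvgD; last exact: cvg_cst.
  by apply: cvgB; [exact: cvg_id|exact: cvg_cst].
have H (c : R) : {for t, continuous (fun v : R => (v - x + c + `|v - x + c|) / 2)}.
  apply: cvgMl; apply: cvgD; first exact: C.
  by apply: cvg_norm; exact: C.
have H0 : {for t, continuous (fun v : R => (v - x + `|v - x|) / 2)}.
  rewrite (_ : (fun v : R => _) = fun v : R => (v - x + 0 + `|v - x + 0|) / 2).
    exact: H.
  by apply/funext => v; rewrite addr0.
apply: cvgMl; apply: cvgD; last exact: H.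
by apply: cvgB => //; apply: cvgB => //; exact: H.
Qed.

Lemma tent_out (R : realType) (x e t : R) : 0 < e -> e <= `|t - x| -> tent x e t = 0.
Proof.
move=> e0; rewrite /tent !hinge'E ler_normr => /orP[h|h];
  apply/eqP; rewrite mulf_eq0; apply/orP; left; apply/eqP;
  rewrite /Num.max; do ![case: ifP]; lra.
Qed.

Lemma tent_ge0 (R : realType) (x e t : R) : 0 < e -> 0 <= tent x e t.
Proof.
move=> e0; rewrite /tent !hinge'E divr_ge0 ?sqr_ge0//.
rewrite /Num.max; do ![case: ifP]; lra.
Qed.

Lemma tent_le (R : realType) (x e t : R) : 0 < e -> tent x e t <= e^-1.
Proof.
move=> e0; rewrite /tent !hinge'E ler_pdivrMr ?exprn_gt0// expr2 mulKf ?gt_eqF//.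
rewrite /Num.max; do ![case: ifP]; lra.
Qed.

Lemma step_left (R : realType) (x e t : R) : 0 < e -> t <= x - e -> step x e t = 0.
Proof.
move=> e0 h; rewrite /step !hingeE !max_r; first by rewrite !expr2; field; lra.
all: lra.
Qed.

Lemma step_right (R : realType) (x e t : R) : 0 < e -> x + e <= t -> step x e t = 1.
Proof.
move=> e0 h; rewrite /step !hingeE !max_l; first by rewrite !expr2; field; lra.
all: lra.
Qed.

Lemma step_ge0 (R : realType) (x e t : R) : 0 < e -> 0 <= step x e t.
Proof.
move=> e0; rewrite /step !hingeE divr_ge0 ?sqr_ge0//.
rewrite /Num.max; do ![case: ifP]; nra.
Qed.

Lemma step_le1 (R : realType) (x e t : R) : 0 < e -> step x e t <= 1.
Proof.
move=> e0; rewrite /step !hingeE ler_pdivrMr ?exprn_gt0// mul1r.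
rewrite /Num.max; do ![case: ifP]; nra.
Qed.

(** Both an integrability criterion and an error bound. The weight w is a tent in one use; in the
    other it is the difference between a smoothed and a sharp indicator, which lives on a small set
    B. *)
Lemma Rintegral_mul_le (d : measure_display) (T : measurableType d) (R : realType)
    (mu : {measure set T -> \bar R}) (D B : set T) (f w : T -> R) (C : R) :
  mu.-integrable D (EFin \o f) ->
  measurable D -> measurable B -> B `<=` D -> measurable_fun D w -> 0 <= C ->
  (forall x, B x -> `|w x| <= C) -> (forall x, D x -> ~ B x -> w x = 0) ->
  mu.-integrable D (EFin \o (fun x => f x * w x)) /\
  `|\int[mu]_(x in D) (f x * w x)| <=
    C * \int[mu]_(x in B) `|f x|.
Proof.
move=> intf mD mB BD mw C0 wB wN.
have intfn : mu.-integrable D (EFin \o (fun x => C * `|f x|)).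
  have := integrableZl mD C (integrable_abse intf).
  by apply: eq_integrable.
have mf : measurable_fun D f by case/integrableP : intf => /measurable_EFinP.
have le1 x : D x -> `|f x * w x| <= ((fun x => C * `|f x|) \_ B) x.
  move=> Dx; rewrite patchE; case: ifPn => [/set_mem Bx|/negP nB].
    by rewrite normrM mulrC ler_wpM2r// wB.
  by rewrite wN ?mulr0 ?normr0// => Bx; apply: nB; exact: mem_set.
have intB : mu.-integrable D
    (EFin \o ((fun x => C * `|f x|) \_ B)).
  rewrite -restrict_EFin; apply/integrable_restrict => //.
  by apply: (integrableS mD _ _ intfn) => //; exact: measurableI.
have intfw : mu.-integrable D (EFin \o (fun x => f x * w x)).
  apply: le_integrable intB => //.
    by apply/measurable_EFinP; exact: measurable_funM.
  by move=> x Dx /=; rewrite lee_fin; apply: (le_trans (le1 _ Dx)); exact: ler_norm.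
split=> //; apply: (le_trans (le_normr_Rintegral mD intfw)).
apply: (@le_trans _ _ (\int[mu]_(x in D) ((fun x => C * `|f x|) \_ B) x)).
  apply: le_Rintegral => //.
  exact: (integrable_abse intfw).
rewrite -Rintegral_mkcondr setIidr// RintegralZl//.
apply: integrableS (integrable_abse intf) => //.
Qed.

Lemma ball_subset01 (R : realType) (x e : R) : 0 < x - e -> x + e < 1 ->
  ball x e `<=` `]0, 1[.
Proof.
move=> xe0 xe1 t; rewrite /ball /= ltr_distl => /andP[t1 t2].
by rewrite in_itv /=; apply/andP; split; lra.
Qed.

Lemma integrable01_cst (R : realType) (c : R) :
  (@lebesgue_measure R).-integrable `]0, 1[ (EFin \o cst c).
Proof.
apply: measurable_bounded_integrable => //.
  by rewrite /= lebesgue_measure_itv /= lte_fin ltr01 ltry.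
by exists `|c|; split; [exact: num_real|move=> M cM t _ /=; exact: ltW].
Qed.

Lemma Rintegral_tent (R : realType) (x e : R) : 0 < e -> 0 < x - e -> x + e < 1 ->
  \int[@lebesgue_measure R]_(t in `]0, 1[) tent x e t = 1.
Proof.
move=> e0 xe0 xe1.
have ct := @tent_cont R x e.
have -> : \int[@lebesgue_measure R]_(t in `]0, 1[) tent x e t =
    \int[@lebesgue_measure R]_(t in `[0, 1]) tent x e t.
  rewrite /Rintegral [in RHS]integral_itv_bndoo//.
  by apply/measurable_EFinP; apply: measurable_funTS; exact: continuous_measurable_fun.
have cw (h : R -> R) : continuous h -> {within `[0, 1], continuous h}.
  exact: continuous_subspaceT.
have cs : continuous (step x e).
  move=> t; apply: differentiable_continuous; apply/derivable1_diffP.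
  by have [] := is_derive_step x e t.
rewrite /Rintegral (@continuous_FTC2 _ _ (step x e))//.
- have -> : step x e 1 = 1 by apply: step_right => //; lra.
  have -> : step x e 0 = 0 by apply: step_left => //; lra.
  by rewrite -EFinB /= subr0.
- exact: cw.
- split.
  + by move=> t _; have [] := is_derive_step x e t.
  + exact: cvg_at_right_filter (cs 0).
  + exact: cvg_at_left_filter (cs 1).
- move=> t _; rewrite derive1E; exact: (@derive_val _ _ _ _ _ _ _ (is_derive_step x e t)).
Qed.


(** A ball of radius e has measure 2 e, so an average below eta / 2 is an integral below eta e. The
    ball is also kept inside ]0, 1[, where the cutoff of u is invisible. *)
Lemma lebesgue_pt_Rintegral (R : realType) (u : R -> R) (x eta : R) :
  (@lebesgue_measure R).-integrable `]0, 1[ (EFin \o u) -> 0 < x < 1 ->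
  lebesgue_pt (u \_ `]0, 1[) x -> 0 < eta ->
  exists2 d, 0 < d & forall e, 0 < e < d ->
    [/\ 0 < x - e, x + e < 1 &
      \int[@lebesgue_measure R]_(t in ball x e) `|u t - u x| < eta * e].
Proof.
move=> intu /andP[x0 x1] /fine_cvgP[_ /cvgrPdist_lt] /(_ (eta / 2)) + eta0.
have eta20 : 0 < eta / 2 by rewrite divr_gt0.
move=> /(_ eta20) [d /= d0 Hd].
exists (Num.min d (Num.min x (1 - x))).
  by rewrite !lt_min d0 x0 subr_gt0 x1.
move=> e /andP[e0]; rewrite !lt_min => /andP[ed /andP[ex e1x]].
have xe0 : 0 < x - e by lra.
have xe1 : x + e < 1 by lra.
split=> //.
have := Hd e; rewrite /= !sub0r !normrN (gtr0_norm e0) => /(_ ed e0).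
have mb : measurable (ball x e) by exact: measurable_ball.
have bD := ball_subset01 xe0 xe1.
have intub : (@lebesgue_measure R).-integrable (ball x e) (EFin \o u).
  by apply: integrableS intu.
have intcb : (@lebesgue_measure R).-integrable (ball x e) (EFin \o cst (u x)).
  by apply: integrableS (integrable01_cst (u x)).
have intb : (@lebesgue_measure R).-integrable (ball x e) (EFin \o (fun t => u t - u x)).
  have -> : EFin \o (fun t => u t - u x) = ((EFin \o u) \- (EFin \o cst (u x)))%E.
    by apply/funext => t /=; rewrite EFinB.
  exact: integrableB.
rewrite /davg /iavg lebesgue_measure_ball ?ltW//=.
rewrite [X in (_ * X)%E](_ : _ =
   \int[lebesgue_measure]_(y in ball x e) (`|u y - u x|)%:E)%E; last first.
  apply: eq_integral => y /set_mem yb; rewrite /= !patchE !mem_set//=.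
    by rewrite in_itv /= x0 x1.
  exact: bD.
rewrite fineM; last 2 first.
- by rewrite inver gt_eqF ?mulrn_wgt0.
- apply: integrable_fin_num => //.
  by have := integrable_abse intb; apply: eq_integrable.
rewrite inver mulrn_eq0 /= gt_eqF//= -/(Rintegral _ _ _) ger0_norm; last first.
  by rewrite mulr_ge0 ?Rintegral_ge0// invr_ge0 mulrn_wge0// ltW.
rewrite mulrC ltr_pdivrMr; last by rewrite mulrn_wgt0.
by have -> : eta / 2 * (e *+ 2) = eta * e by rewrite -mulr_natr; field.
Qed.

(** The tent has integral 1 and height at most 1 / e, so the error is at most 1 / e times the
    integral of |u - u x| over the ball. *)
Lemma tent_avg (R : realType) (u : R -> R) (x eta : R) :
  (@lebesgue_measure R).-integrable `]0, 1[ (EFin \o u) -> 0 < x < 1 ->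
  lebesgue_pt (u \_ `]0, 1[) x -> 0 < eta ->
  exists2 d, 0 < d & forall e, 0 < e < d ->
   (@lebesgue_measure R).-integrable `]0, 1[ (EFin \o (fun t => u t * tent x e t)) /\
   `|\int[@lebesgue_measure R]_(t in `]0, 1[) (u t * tent x e t) - u x| < eta.
Proof.
move=> intu x01 ux eta0.
have [d d0 Hd] := lebesgue_pt_Rintegral intu x01 ux eta0.
exists d => // e /andP[e0 ed].
have [|xe0 xe1 He] := Hd e; first by rewrite e0.
have mD : measurable (`]0, 1[ : set R) by exact: measurable_itv.
have mb : measurable (ball x e) by exact: measurable_ball.
have bD := ball_subset01 xe0 xe1.
have mt : measurable_fun (`]0, 1[ : set R) (tent x e).
  by apply: measurable_funTS; apply: continuous_measurable_fun; exact: tent_cont.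
have intc := @integrable01_cst R.
have intuc : (@lebesgue_measure R).-integrable `]0, 1[ (EFin \o (fun t => u t - u x)).
  have -> : EFin \o (fun t => u t - u x) = ((EFin \o u) \- (EFin \o cst (u x)))%E.
    by apply/funext => t /=; rewrite EFinB.
  exact: integrableB.
have tB t : (ball x e) t -> `|tent x e t| <= e^-1.
  by rewrite ger0_norm ?tent_ge0// => _; exact: tent_le.
have tN t : `]0, 1[%classic t -> ~ (ball x e) t -> tent x e t = 0.
  move=> _ /negP nb; apply: tent_out => //.
  by move: nb; rewrite -leNgt distrC.
have ei0 : 0 <= e^-1 by rewrite invr_ge0 ltW.
have [i1 b1] := Rintegral_mul_le intuc mD mb bD mt ei0 tB tN.
have [i2 _] := Rintegral_mul_le (intc (u x)) mD mb bD mt ei0 tB tN.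
have [i3 _] := Rintegral_mul_le intu mD mb bD mt ei0 tB tN.
have [i4 _] := Rintegral_mul_le (intc 1) mD mb bD mt ei0 tB tN.
split => //.
have -> : \int[@lebesgue_measure R]_(t in `]0, 1[) (u t * tent x e t) - u x =
   \int[@lebesgue_measure R]_(t in `]0, 1[) ((u t - u x) * tent x e t).
  under [RHS]eq_Rintegral do rewrite mulrBl.
  rewrite RintegralB//; congr (_ - _).
  rewrite RintegralZl//; last by move: i4; apply: eq_integrable => // t _ /=; rewrite mul1r.
  by rewrite Rintegral_tent// mulr1.
apply: (le_lt_trans b1); rewrite mulrC ltr_pdivrMr//.
Qed.

Lemma is_derive_stepB (R : realType) (x y e t : R) :
  is_derive t 1 (fun s => step x e s - step y e s) (tent x e t - tent y e t).
Proof.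
have h1 := is_derive_step x e t; have h2 := is_derive_step y e t.
exact: is_deriveB.
Qed.

Lemma derive1_stepB (R : realType) (x y e : R) :
  derive1 (fun s => step x e s - step y e s) = fun t => tent x e t - tent y e t.
Proof.
apply/funext => t; rewrite derive1E.
exact: (@derive_val _ _ _ _ _ _ _ (is_derive_stepB x y e t)).
Qed.

Lemma stepB_test (R : realType) (x y e : R) :
  0 < e -> 0 < x - e -> x < y -> y + e < 1 ->
  test_fun (fun s => step x e s - step y e s).
Proof.
move=> e0 xe xy ye; split.
- by move=> t; have [] := is_derive_stepB x y e t.
- by rewrite derive1_stepB => t; apply: cvgB; exact: tent_cont.
- exists (x - e), (y + e); split => // t.
  rewrite /= in_itv /= => /negP; rewrite negb_and -!ltNge => /orP[h|h].
    by rewrite !step_left ?subrr//; lra.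
  by rewrite !step_right ?subrr//; lra.
Qed.

Lemma stepB_indic (R : realType) (x y e t : R) :
  0 < e -> e + e <= y - x -> e <= `|t - x| -> e <= `|t - y| ->
  step x e t - step y e t = \1_(`]x, y]%classic) t.
Proof.
move=> e0 exy h1 h2.
rewrite indicE mem_setE in_itv /=.
have [tx|tx] := lerP t (x - e).
  rewrite !step_left//; last by lra.
  rewrite (_ : (x < t) = false) /= ?subrr//; apply/negP; lra.
have xt : x + e <= t by move: h1; rewrite ler_normr => /orP[]; lra.
rewrite step_right// (_ : x < t) /=; last by lra.
have [ty|ty] := lerP t (y - e).
  by rewrite step_left// subr0 (_ : t <= y)//; lra.
have yt : y + e <= t by move: h2; rewrite ler_normr => /orP[]; lra.
by rewrite step_right// subrr (_ : (t <= y) = false)//; apply/negP; lra.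
Qed.

Lemma stepB_indic_le (R : realType) (x y e t : R) (A : set R) :
  0 < e -> `|step x e t - step y e t - \1_A t| <= 2.
Proof.
move=> e0; have := step_ge0 x t e0; have := step_ge0 y t e0.
have := step_le1 x t e0; have := step_le1 y t e0.
rewrite indicE ler_norml; case: (t \in A) => /= *; apply/andP; split; lra.
Qed.

(** These are the constraints on e in [weak_deriv_increment]; 4 e bounds the measure of a union of
    two balls of radius e. *)
Lemma small_radius (R : realType) (d1 d2 d3 x y : R) :
  0 < d1 -> 0 < d2 -> 0 < d3 -> 0 < x -> x < y -> y < 1 ->
  exists2 e, 0 < e & [/\ e < d1, e < d2, e + e + e + e < d3, 0 < x - e &
     [/\ y + e < 1, x + e < 1, 0 < y - e & e + e <= y - x]].
Proof.
move=> d10 d20 d30 x0 xy y1.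
pose m := Num.min (Num.min d1 d2) (Num.min (Num.min x (1 - y)) (Num.min (y - x) d3)).
have m0 : 0 < m by rewrite !lt_min d10 d20 x0 !subr_gt0 y1 xy d30.
have : m <= m by [].
rewrite {2}/m !le_min => /andP[/andP[h1 h2] /andP[/andP[h3 h4] /andP[h5 h6]]].
move: m m0 h1 h2 h3 h4 h5 h6 => m m0 h1 h2 h3 h4 h5 h6.
by exists (m / 5); [lra|split; try split; lra].
Qed.

(** The test function [step x e - step y e] is a smoothed indicator of ]x, y], and its derivative
    averages u near x minus u near y. As e tends to 0, the averages tend to the values at the two
    Lebesgue points, and the other side tends to the integral of g up to sign. *)
Lemma weak_deriv_increment (R : realType) (u g : R -> R) (x y : R) :
  (@lebesgue_measure R).-integrable `]0, 1[ (EFin \o u) ->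
  (@lebesgue_measure R).-integrable `]0, 1[ (EFin \o g) ->
  is_weak_deriv u g -> 0 < x -> x < y -> y < 1 ->
  lebesgue_pt (u \_ `]0, 1[) x -> lebesgue_pt (u \_ `]0, 1[) y ->
  u y - u x = \int[@lebesgue_measure R]_(t in `]x, y]) g t.
Proof.
move=> intu intg wd x0 xy y1 ux uy; apply/eqP; rewrite -subr_eq0 -normr_le0.
apply/ler_addgt0Pr => eta eta0; rewrite add0r.
(* Error budget: eta / 4 for each of the two averages of u, and twice eta / 4 for g, because the
   test function differs from the indicator by at most 2, and only on the two balls. *)
have eta4 : 0 < eta / 4 by rewrite divr_gt0.
have x01 : 0 < x < 1 by rewrite x0 (lt_trans xy).
have y01 : 0 < y < 1 by rewrite y1 (lt_trans x0).
have [dx dx0 Hx] := tent_avg intu x01 ux eta4.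
have [dy dy0 Hy] := tent_avg intu y01 uy eta4.
have mD : measurable (`]0, 1[ : set R) by exact: measurable_itv.
have intgT : (@lebesgue_measure R).-integrable setT (EFin \o (g \_ `]0, 1[)).
  by rewrite -restrict_EFin; apply/integrable_restrict => //; rewrite setTI.
have [dg [dg0 Hg]] := integral_normr_continuous intgT eta4.
have [e e0 [edx edy edg xe0 [ye1 xe1 ye0 exy]]] := small_radius dx0 dy0 dg0 x0 xy y1.
have [|i1 b1] := Hx e; first by rewrite e0.
have [|i2 b2] := Hy e; first by rewrite e0.
pose phi (t : R) : R := step x e t - step y e t.
have := wd _ (stepB_test e0 xe0 xy ye1); rewrite derive1_stepB -/phi.
under eq_Rintegral do rewrite mulrBr.
rewrite RintegralB//.
set A := [set` `]x, y]].
pose B := (ball x e `|` ball y e : set R).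
have mA : measurable A by exact: measurable_itv.
have mB : measurable B by apply: measurableU; exact: measurable_ball.
have AD : A `<=` `]0, 1[.
  move=> t; rewrite /A /= !in_itv/= => /andP[t1 t2].
  by rewrite (lt_trans x0 t1) (le_lt_trans t2 y1).
have BD : B `<=` `]0, 1[ by move=> t []; exact: ball_subset01.
have cphi : continuous phi.
  move=> t; apply: differentiable_continuous; apply/derivable1_diffP.
  by have [] := is_derive_stepB x y e t.
have mphi : measurable_fun (`]0, 1[ : set R) phi.
  by apply: measurable_funTS; exact: continuous_measurable_fun.
have mw : measurable_fun (`]0, 1[ : set R) (fun t => phi t - \1_A t).
  by apply: measurable_funB => //; exact: measurable_indic.
have w2 t : B t -> `|phi t - \1_A t| <= 2 by move=> _; exact: stepB_indic_le.
have wN t : `]0, 1[%classic t -> ~ B t -> phi t - \1_A t = 0.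
  move=> _ /not_orP[]; rewrite /ball /= => /negP; rewrite -leNgt distrC => h1.
  move=> /negP; rewrite -leNgt distrC => h2.
  by rewrite /phi stepB_indic// subrr.
have [i3 b3] := Rintegral_mul_le intg mD mB BD mw (ler0n _ 2) w2 wN.
have i4 : (@lebesgue_measure R).-integrable `]0, 1[ (EFin \o (g \_ A)).
  by rewrite -restrict_EFin; apply/integrable_restrict => //; rewrite setIidr//;
    apply: integrableS intg.
have -> : \int[@lebesgue_measure R]_(t in `]0, 1[) (g t * phi t) =
    \int[@lebesgue_measure R]_(t in `]0, 1[) (g t * (phi t - \1_A t)) +
    \int[@lebesgue_measure R]_(t in A) g t.
  have -> : \int[@lebesgue_measure R]_(t in A) g t =
      \int[@lebesgue_measure R]_(t in `]0, 1[) (g \_ A) t.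
    by rewrite -Rintegral_mkcondr setIidr.
  rewrite -RintegralD//.
  apply: eq_Rintegral => t _; rewrite [in RHS]mulrBr patchE indicE.
  by case: (t \in A); rewrite ?mulr1n ?mulr1 ?subrK ?mulr0n ?mulr0 ?subr0 ?addr0.
have : \int[@lebesgue_measure R]_(t in B) `|g t| < eta / 4.
  have -> : \int[@lebesgue_measure R]_(t in B) `|g t| =
     \int[@lebesgue_measure R]_(t in B) `|(g \_ `]0, 1[) t|.
    by apply: eq_Rintegral => t /set_mem Bt; rewrite patchE mem_set//; exact: BD.
  apply: Hg => //; apply: (le_lt_trans (measureU2 _ _ _)) => //;
    try exact: measurable_ball.
  have mub z : (lebesgue_measure (ball z e) <= (e *+ 2)%:E)%E.
    by rewrite le_eqVlt; apply/orP; left; apply/eqP; exact: (lebesgue_measure_ball _ (ltW e0)).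
  apply: (le_lt_trans (leeD (mub x) (mub y))).
  by rewrite -EFinD lte_fin !mulr2n addrA.
move: b1 b2 b3.
set I1 := Rintegral _ _ _; set I2 := Rintegral _ _ _; set I3 := Rintegral _ _ _.
set I4 := Rintegral _ _ _; set I5 := Rintegral _ _ _.
clearbody I1 I2 I3 I4 I5; clear -eta0.
rewrite !ltr_norml !ler_norml.
move=> /andP[h1 h2] /andP[h3 h4] /andP[h5 h6] h7 h8.
apply/andP; split; lra.
Qed.

(** * Sobolev functions are continuously differentiable *)

Lemma ae_exists (R : realType) (P : R -> Prop) (a b : R) :
  {ae @lebesgue_measure R, forall x, P x} -> a < b -> exists2 x, a < x < b & P x.
Proof.
move=> [N [mN N0 PN]] ab; apply: contrapT => noP.
have abN : `]a, b[ `<=` N.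
  move=> x; rewrite /= in_itv /= => xab; apply: PN => /= Px; apply: noP; by exists x.
have : (@lebesgue_measure R `]a, b[ <= 0)%E.
  by rewrite -N0; apply: (le_measure (@lebesgue_measure R)); rewrite ?inE//; exact: measurable_itv.
by rewrite lebesgue_measure_itv /= lte_fin ab -EFinD lee_fin subr_le0 leNgt ab.
Qed.

(** The lower limit -oo avoids a case distinction on the sign of x; h is cut off to a bounded
    interval before being integrated. *)
Definition primitive (R : realType) (h : R -> R) (x : R) : R :=
  \int[@lebesgue_measure R]_(t in `]-oo, x]) h t.

Section primitive.
Variables (R : realType) (h : R -> R).
Hypothesis inth : (@lebesgue_measure R).-integrable setT (EFin \o h).

Lemma primitiveB (x y : R) : x <= y ->
  primitive h y - primitive h x = \int[@lebesgue_measure R]_(t in `]x, y]) h t.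
Proof.
move=> xy; apply: Rintegral_itvB => //.
by apply: integrableS inth => //; exact: measurable_itv.
Qed.

Lemma primitiveB_le (x y : R) : x <= y ->
  `|primitive h y - primitive h x| <= \int[@lebesgue_measure R]_(t in `]x, y]) `|h t|.
Proof.
move=> xy; rewrite primitiveB//; apply: le_normr_Rintegral => //.
by apply: integrableS inth => //; exact: measurable_itv.
Qed.

Lemma primitive_continuous : continuous (primitive h).
Proof.
move=> x; apply/cvgrPdist_lt => e e0.
have [d [d0 Hd]] := integral_normr_continuous inth e0.
near=> y.
have xyd : `|x - y| < d.
  by near: y; apply/nbhs_ballP; exists d.
have [xy|yx] := lerP x y.
  rewrite distrC; apply: (le_lt_trans (primitiveB_le xy)).
  apply: Hd => //; rewrite /= lebesgue_measure_itv /= lte_fin; case: ifP => // xy'.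
  by rewrite -EFinD lte_fin; apply: le_lt_trans xyd; rewrite distrC ler_norm.
apply: (le_lt_trans (primitiveB_le (ltW yx))).
apply: Hd => //; rewrite /= lebesgue_measure_itv /= lte_fin yx.
by rewrite -EFinD lte_fin; apply: le_lt_trans xyd; rewrite ler_norm.
Unshelve. all: by end_near.
Qed.

Lemma is_derive_primitive (x : R) : {for x, continuous h} ->
  is_derive x 1 (primitive h) (h x).
Proof.
move=> hx.
have [|||d1 d2] := @continuous_FTC1 R h -oo%O x (x + 1) _ _ _ hx.
- by rewrite ltrDl.
- by apply: integrableS inth => //; exact: measurable_itv.
- by rewrite ltNyr.
- by split => //; rewrite -derive1E.
Qed.

End primitive.

(** |f| <= f^2 + 1, and ]0, 1[ has finite measure. *)
Lemma square_integrable_integrable (R : realType) (f : R -> R) :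
  square_integrable f -> (@lebesgue_measure R).-integrable `]0, 1[ (EFin \o f).
Proof.
move=> [mf intf2].
have mD : measurable (`]0, 1[ : set R) by exact: measurable_itv.
have int1 := @integrable01_cst R 1.
have int2 := integrableD (mu := @lebesgue_measure R) mD intf2 int1.
apply: le_integrable int2 => //; first exact/measurable_EFinP.
move=> x _ /=; rewrite lee_fin (le_trans _ (ler_norm _))//.
have := sqr_ge0 (f x - 1); have := sqr_ge0 (f x + 1).
rewrite !expr2 ler_norml => *; apply/andP; split; nra.
Qed.

(** A substitute for Cauchy-Schwarz: (|f| - e)^2 >= 0 gives |f| <= f^2 / (2 e) + e / 2, and each of
    the two terms has integral at most e / 2. *)
Lemma Rintegral_norm_le (R : realType) (f : R -> R) (e : R) : 0 < e ->
  square_integrable f ->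
  (\int[@lebesgue_measure R]_(x in `]0%R, 1%R[) (f x ^+ 2)%:E < (e ^+ 2)%:E)%E ->
  \int[@lebesgue_measure R]_(x in `]0, 1[) `|f x| <= e.
Proof.
move=> e0 sf fe; have intf := square_integrable_integrable sf.
have [mf intf2] := sf.
have mD : measurable (`]0, 1[ : set R) by exact: measurable_itv.
have intc := @integrable01_cst R.
have intg : (@lebesgue_measure R).-integrable `]0, 1[
    (EFin \o (fun x => (2 * e)^-1 * f x ^+ 2)).
  have := integrableZl (mu := @lebesgue_measure R) mD (2 * e)^-1 intf2.
  by apply: eq_integrable.
have intg2 : (@lebesgue_measure R).-integrable `]0, 1[
    (EFin \o (fun x => (2 * e)^-1 * f x ^+ 2 + e / 2)).
  have := integrableD (mu := @lebesgue_measure R) mD intg (intc (e / 2)).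
  by apply: eq_integrable.
apply: (@le_trans _ _ (\int[@lebesgue_measure R]_(x in `]0, 1[) ((2 * e)^-1 * f x ^+ 2 + e / 2))).
  apply: le_Rintegral => //.
    have := integrable_abse intf; by apply: eq_integrable.
  move=> x _; rewrite -subr_ge0.
  have -> : (2 * e)^-1 * f x ^+ 2 + e / 2 - `|f x| = (`|f x| - e) ^+ 2 / (2 * e).
    by rewrite -(real_normK (num_real (f x))); field; lra.
  by rewrite divr_ge0 ?sqr_ge0// mulr_ge0// ltW.
rewrite RintegralD//; last exact: intc.
have -> : \int[@lebesgue_measure R]_(x in `]0, 1[) (e / 2) = e / 2 * fine (@lebesgue_measure R `]0, 1[).
  exact: Rintegral_cst.
rewrite RintegralZl//.
have -> : fine (@lebesgue_measure R `]0, 1[) = 1.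
  by rewrite lebesgue_measure_itv /= lte_fin ltr01 /= subr0.
have : \int[@lebesgue_measure R]_(x in `]0, 1[) (f x ^+ 2) <= e ^+ 2.
  rewrite -lee_fin /Rintegral fineK; first exact: ltW.
  exact: integrable_fin_num.
set I := Rintegral _ _ _ => Ie.
have : (2 * e)^-1 * I <= (2 * e)^-1 * e ^+ 2 by rewrite ler_wpM2l// invr_ge0; lra.
have -> : (2 * e)^-1 * e ^+ 2 = e / 2 by field; lra.
rewrite mulr1; lra.
Qed.

Lemma ae_imp (R : realType) (P Q : R -> Prop) :
  {ae @lebesgue_measure R, forall x, P x} -> (forall x, P x -> Q x) ->
  {ae @lebesgue_measure R, forall x, Q x}.
Proof.
move=> [N [mN N0 PN]] PQ; exists N; split => // x nQ; apply: PN => Px.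
exact: nQ (PQ x Px).
Qed.

(** One Lebesgue point x0 fixes the constant, since u and [primitive h] have the same increments
    between Lebesgue points. Letting h differ from g on a null set allows h to be a continuous
    representative of g. *)
Lemma weak_deriv_primitive (R : realType) (u g h : R -> R) :
  (@lebesgue_measure R).-integrable `]0, 1[ (EFin \o u) ->
  (@lebesgue_measure R).-integrable `]0, 1[ (EFin \o g) ->
  (@lebesgue_measure R).-integrable setT (EFin \o h) ->
  is_weak_deriv u g ->
  {ae @lebesgue_measure R, forall x, `]0, 1[%classic x -> g x = h x} ->
  exists c, {ae @lebesgue_measure R, forall x, `]0, 1[%classic x -> u x = c + primitive h x}.
Proof.
move=> intu intg inth wd gh.
have locu : locally_integrable setT (u \_ `]0, 1[).
  by apply: integrable_locally_restrict.
have leb := lebesgue_differentiation locu.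
have inc x y : 0 < x -> x < y -> y < 1 ->
    lebesgue_pt (u \_ `]0, 1[) x -> lebesgue_pt (u \_ `]0, 1[) y ->
    u y - u x = primitive h y - primitive h x.
  move=> x0 xy y1 ux uy; rewrite (weak_deriv_increment intu intg wd x0 xy y1 ux uy).
  rewrite primitiveB ?ltW// /Rintegral; congr fine.
  have sub : `]x, y] `<=` (`]0, 1[ : set R).
    move=> t; rewrite /= !in_itv/= => /andP[t1 t2].
    by rewrite (lt_trans x0 t1) (le_lt_trans t2 y1).
  apply: ae_eq_integral => //.
  - by have /integrableP[mg _] := intg; apply: measurable_funS mg.
  - by have /integrableP[mh _] := inth; apply: measurable_funS mh.
  - have ghE : {ae @lebesgue_measure R, forall t, `]x, y]%classic t ->
        (EFin \o g) t = (EFin \o h) t}.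
      by apply: (ae_imp gh) => t Ht /sub /Ht /= ->.
    exact: ghE.
have [x0 /andP[x00 x01] ux0] := ae_exists leb (@ltr01 R).
exists (u x0 - primitive h x0).
apply: (ae_imp leb) => x ux; rewrite /= in_itv /= => /andP[xp x1].
have [lt|gt|<-] := ltgtP x x0.
- by have := inc x x0 xp lt x01 ux ux0; lra.
- by have := inc x0 x x00 gt x1 ux0 ux; lra.
- by rewrite subrK.
Qed.

Lemma integrable_extend (R : realType) (g : R -> R) :
  (@lebesgue_measure R).-integrable `]0, 1[ (EFin \o g) ->
  (@lebesgue_measure R).-integrable setT (EFin \o (g \_ `]0, 1[)).
Proof.
move=> intg; rewrite -restrict_EFin; apply/integrable_restrict => //.
by rewrite setTI.
Qed.

(* Cutting off outside [-1, 2] makes the derivatives of primitives two-sided at 0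
   and 1. *)
Lemma integrable_cut (R : realType) (G : R -> R) : continuous G ->
  (@lebesgue_measure R).-integrable setT (EFin \o (G \_ `[-1, 2])).
Proof.
move=> cG; rewrite -restrict_EFin; apply/integrable_restrict => //.
rewrite setTI; apply: continuous_compact_integrable; first exact: segment_compact.
exact: continuous_subspaceT.
Qed.

Lemma cut_continuous (R : realType) (G : R -> R) (x : R) : continuous G ->
  0 <= x <= 1 -> {for x, continuous (G \_ `[-1, 2])}.
Proof.
move=> cG /andP[x0 x1].
have near_eq : \near x, G x = (G \_ `[-1, 2]) x.
  have h1 : -1 < x by lra.
  have h2 : x < 2 by lra.
  near=> y.
  rewrite patchE mem_set//= in_itv /=; apply/andP; split; apply: ltW.
    by near: y; exact: lt_nbhsr.
  by near: y; exact: lt_nbhsl.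
have eqx : (G \_ `[-1, 2]) x = G x by rewrite (nbhs_singleton near_eq).
rewrite /prop_for /continuous_at eqx.
apply: cvg_trans (cG x).
exact: near_eq_cvg.
Unshelve. all: by end_near.
Qed.

Lemma primitive_dist (R : realType) (g h : R -> R) :
  (@lebesgue_measure R).-integrable `]0, 1[ (EFin \o g) ->
  (@lebesgue_measure R).-integrable setT (EFin \o h) ->
  {ae @lebesgue_measure R, forall x, `]0, 1[%classic x -> g x = h x} ->
  forall x y, 0 <= x <= 1 -> 0 <= y <= 1 ->
  `|primitive h y - primitive h x| <= \int[@lebesgue_measure R]_(t in `]0, 1[) `|g t|.
Proof.
move=> intg inth gh x y.
wlog xy : x y / x <= y => [W hx hy|/andP[x0 _] /andP[_ y1]].
  case: (lerP x y) => [xy|/ltW yx]; first exact: W.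
  by rewrite distrC; exact: W.
apply: (le_trans (primitiveB_le inth xy)).
have inth' : (@lebesgue_measure R).-integrable setT (EFin \o (fun t => `|h t|)).
  exact: (integrable_abse inth).
have i2 : (@lebesgue_measure R).-integrable `]0, 1] (EFin \o (fun t => `|h t|)).
  by apply: integrableS inth' => //; exact: measurable_itv.
have -> : \int[@lebesgue_measure R]_(t in `]0, 1[) `|g t| =
    \int[@lebesgue_measure R]_(t in `]0, 1]) `|h t|.
  rewrite -Rintegral_itv_bndo_bndc; last first.
    by apply: integrableS inth' => //; exact: measurable_itv.
  rewrite /Rintegral; congr fine; apply: ae_eq_integral => //.
  - have /integrableP[mg _] := integrable_abse intg.
    exact: mg.
  - by have /integrableP[mh _] := inth'; apply: measurable_funS mh.
  - have ghE : {ae @lebesgue_measure R, forall t, `]0, 1[%classic t ->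
        (`|g t|)%:E = (`|h t|)%:E}.
      by apply: (ae_imp gh) => t Ht /Ht ->.
    exact: ghE.
rewrite /Rintegral; apply: fine_le.
- apply: integrable_fin_num => //.
  by apply: integrableS inth' => //; exact: measurable_itv.
- exact: integrable_fin_num.
- apply: ge0_subset_integral => //.
  + by have /integrableP[mh _] := i2.
  + move=> t; rewrite /= !in_itv/= => /andP[t1 t2].
    by rewrite (le_lt_trans x0 t1) (le_trans t2 y1).
Qed.

(** Induction along the chain: the shifted chain g 1, g 2, ... has continuous representatives by
    induction, and integrating that of g 1 gives a differentiable one of g 0. One order is lost,
    because the last function of the chain is merely square integrable. *)
Lemma sobolev_C (R : realType) (r : nat) (g : nat -> R -> R) :
  (forall k, (k <= r.+1)%N -> square_integrable (g k)) ->
  (forall k, (k < r.+1)%N -> is_weak_deriv (g k) (g k.+1)) ->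
  exists G : nat -> R -> R,
  [/\ forall k, continuous (G k),
      forall k, (k < r)%N -> forall x : R, 0 <= x <= 1 -> is_derive x 1 (G k) (G k.+1 x),
      forall k, (k <= r)%N ->
        {ae @lebesgue_measure R, forall x, `]0, 1[%classic x -> g k x = G k x}
    & forall k, (k <= r)%N -> forall x y, 0 <= x <= 1 -> 0 <= y <= 1 ->
        `|G k y - G k x| <= \int[@lebesgue_measure R]_(t in `]0, 1[) `|g k.+1 t|].
Proof.
elim: r g => [|r IH] g sg wg.
  have i0 := square_integrable_integrable (sg 0 isT).
  have i1 := square_integrable_integrable (sg 1 isT).
  have ih := integrable_extend i1.
  have gh : {ae @lebesgue_measure R, forall x, `]0, 1[%classic x ->
      g 1 x = (g 1 \_ `]0, 1[) x}.
    by apply: aeW => x Dx; rewrite patchE mem_set.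
  have [c Hc] := weak_deriv_primitive i0 i1 ih (wg 0 isT) gh.
  (* Beyond continuity only the index 0 is constrained; the constant family fills the other
     indices. *)
  exists (fun _ x => c + primitive (g 1 \_ `]0, 1[) x); split => //.
  - by move=> _ x; apply: cvgD; [exact: cvg_cst|exact: primitive_continuous].
  - by case.
  - case=> // _ x y hx hy; rewrite opprD addrACA subrr add0r.
    exact: (primitive_dist i1 ih gh).
have [|k kr|G [cG dG aG bG]] := IH (fun k => g k.+1).
- by move=> k kr; exact: sg.
- exact: wg.
have i0 := square_integrable_integrable (sg 0 isT).
have i1 := square_integrable_integrable (sg 1 isT).
have ih := integrable_cut (cG 0).
have gh : {ae @lebesgue_measure R, forall x, `]0, 1[%classic x ->
    g 1 x = (G 0 \_ `[-1, 2]) x}.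
  apply: (ae_imp (aG 0 isT)) => x Hx Dx; rewrite patchE mem_set; first exact: Hx.
  move: Dx; rewrite /= !in_itv /= => /andP[x0 x1]; apply/andP; split; lra.
have [c Hc] := weak_deriv_primitive i0 i1 ih (wg 0 isT) gh.
exists (fun k => if k is k'.+1 then G k' else fun x => c + primitive (G 0 \_ `[-1, 2]) x).
split.
- case=> [|k]; last exact: cG.
  by move=> x; apply: cvgD; [exact: cvg_cst|exact: primitive_continuous].
- case=> [_ x x01|k kr x x01]; last exact: dG.
  have -> : G 0 x = (G 0 \_ `[-1, 2]) x.
    rewrite patchE mem_set//= in_itv /=; move: x01 => /andP[h1 h2]; apply/andP; split; lra.
  have := is_derive_primitive ih (cut_continuous (cG 0) x01) => dp.
  rewrite -[X in is_derive _ _ _ X]add0r.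
  exact: (is_deriveD (f := cst c)).
- by case=> [|k] kr //; exact: aG.
- case=> [|k] kr x y hx hy; last exact: bG.
  rewrite opprD addrACA subrr add0r.
  exact: (primitive_dist i1 ih gh).
Qed.

(* The functions F (Some N) converge to F None in C^k([0, 1]). *)
Fixpoint Ck_cvg (R : realType) (k : nat) (F : option nat -> R -> R) : Prop :=
  [/\ forall o (x : R), 0 <= x <= 1 -> {for x, continuous (F o)},
      forall e, 0 < e -> exists N0 : nat, forall N, (N0 <= N)%N ->
        forall x, 0 <= x <= 1 -> `|F (Some N) x - F None x| < e
    & if k is k'.+1 then
        exists2 DF : option nat -> R -> R,
          forall o (x : R), 0 <= x <= 1 -> is_derive x 1 (F o) (DF o x)
        & Ck_cvg k' DF
      else True].

Definition cont01 (R : realType) (f : R -> R) :=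
  forall x, 0 <= x <= 1 -> forall e, 0 < e -> exists2 d, 0 < d &
    forall y, 0 <= y <= 1 -> `|y - x| < d -> `|f y - f x| < e.

Lemma abs_continuous01_cont (R : realType) (f : R -> R) :
  abs_continuous01 f -> cont01 f.
Proof.
move=> af x /andP[x0 x1] e e0; have [d d0 Hd] := af e e0.
exists d => // y; move: x x0 x1 y.
have key x y : 0 <= x -> y <= 1 -> x <= y -> `|y - x| < d -> `|f y - f x| < e.
  move=> x0 y1 xy yxd.
  have := Hd 1 (fun _ => x) (fun _ => y); rewrite !big_ord1; apply => //.
    by move=> i j; rewrite (ord1 i) (ord1 j) eqxx.
  by rewrite ger0_norm ?subr_ge0 in yxd.
move=> x x0 x1 y /andP[y0 y1] yx; case: (lerP x y) => [xy|/ltW xy]; first exact: key.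
by rewrite distrC; apply: key => //; rewrite distrC.
Qed.

Lemma cont01B (R : realType) (f g : R -> R) :
  cont01 f -> cont01 g -> cont01 (fun x => f x - g x).
Proof.
move=> cf cg x x01 e e0; have e20 : 0 < e / 2 by rewrite divr_gt0.
have [d1 d10 H1] := cf x x01 _ e20; have [d2 d20 H2] := cg x x01 _ e20.
exists (Num.min d1 d2) => [|y y01]; first by rewrite lt_min d10.
rewrite lt_min => /andP[/(H1 y y01) h1 /(H2 y y01) h2].
rewrite opprD addrACA -opprD (le_lt_trans (ler_normB _ _))//.
by rewrite (splitr e) ltrD.
Qed.

(** Almost everywhere equality says nothing at x itself, but every interval of positive length in
    [0, 1] contains a point of equality. Intervals on one side of x suffice, so the ends are reached
    too. *)
Lemma ae_eq_cont01 (R : realType) (f G : R -> R) :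
  cont01 f -> continuous G ->
  {ae @lebesgue_measure R, forall x, `]0, 1[%classic x -> f x = G x} ->
  forall x, 0 <= x <= 1 -> f x = G x.
Proof.
move=> cf cG fG x x01; apply/eqP; rewrite -subr_eq0 -normr_le0.
apply/ler_addgt0Pr => e e0; rewrite add0r.
have e20 : 0 < e / 2 by rewrite divr_gt0.
have [d d0 Hd] := cf x x01 _ e20.
have /cvgrPdist_lt/(_ _ e20)/nbhs_ballP[d' /= d'0 Hd'] := cG x.
(* The interval lies to the right of x, except when x = 1. *)
have [a [b [ab [a0 b1] [xa bx]]]] : exists a b, [/\ a < b, 0 <= a /\ b <= 1 &
    x - Num.min d d' <= a /\ b <= x + Num.min d d'].
  set m := Num.min d d'; have m0 : 0 < m by rewrite lt_min d0.
  move: (x01) => /andP[x0 x1].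
  have [x2|x2] := ltrP x 1.
    exists x, (Num.min 1 (x + m)); rewrite lt_min x2 ltrDl m0; split=> //; split => //.
    - by rewrite ge_min lexx.
    - by rewrite gerBl ltW.
    - by rewrite ge_min lexx orbT.
  exists (Num.max 0 (x - m)), x; rewrite gt_max gtrBl m0 (lt_le_trans ltr01 x2).
  split=> //; split => //; first by rewrite le_max lexx.
    by rewrite le_max lexx orbT.
  by rewrite lerDl ltW.
have [y /andP[ay yb] Hy] := ae_exists fG ab.
have y01 : 0 <= y <= 1 by apply/andP; split; lra.
have yx : `|y - x| < Num.min d d'.
  rewrite ltr_distl; apply/andP; split; lra.
move: yx; rewrite lt_min => /andP[yd yd'].
have h1 := Hd y y01 yd.
have h2 : `|G x - G y| < e / 2 by apply: Hd'; rewrite /ball /= distrC.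
have fy : f y = G y by apply: Hy; rewrite /= in_itv /=; apply/andP; split; lra.
have -> : f x - G x = (f x - f y) - (G x - G y) by rewrite fy; ring.
rewrite (le_trans (ler_normB _ _))// (splitr e) ltW// ltrD// distrC //.
Qed.

(** If |E| exceeded 2 e throughout, the integral of |g| would be at least 2 e. So |E| <= 2 e at some
    point, and the oscillation of E adds at most e. *)
Lemma sup_bound (R : realType) (g g1 E : R -> R) (e : R) : 0 < e ->
  continuous E ->
  (@lebesgue_measure R).-integrable `]0, 1[ (EFin \o g) ->
  {ae @lebesgue_measure R, forall x, `]0, 1[%classic x -> g x = E x} ->
  \int[@lebesgue_measure R]_(t in `]0, 1[) `|g t| <= e ->
  \int[@lebesgue_measure R]_(t in `]0, 1[) `|g1 t| <= e ->
  (forall x y, 0 <= x <= 1 -> 0 <= y <= 1 ->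
    `|E y - E x| <= \int[@lebesgue_measure R]_(t in `]0, 1[) `|g1 t|) ->
  forall x, 0 <= x <= 1 -> `|E x| <= 3 * e.
Proof.
move=> e0 cE intg gE ge g1e HE x x01.
have mD : measurable (`]0, 1[ : set R) by exact: measurable_itv.
have cEn : continuous (fun x => `|E x|) by move=> t; apply: cvg_norm; exact: cE.
have [y Dy yE] : exists2 y, `]0, 1[%classic y & `|E y| <= 2 * e.
  apply: contrapT => noy.
  have iE : (@lebesgue_measure R).-integrable `]0, 1[ (EFin \o (fun x => `|E x|)).
    have : (@lebesgue_measure R).-integrable `[0, 1] (EFin \o (fun x => `|E x|)).
      apply: continuous_compact_integrable; first exact: segment_compact.
      exact: continuous_subspaceT.
    by apply: integrableS => //; exact: subset_itvW.
  have ic := integrable01_cst (2 * e).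
  have : 2 * e <= \int[@lebesgue_measure R]_(t in `]0, 1[) `|E t|.
    have -> : 2 * e = \int[@lebesgue_measure R]_(t in `]0, 1[) (2 * e).
      have -> : \int[@lebesgue_measure R]_(t in `]0, 1[) (2 * e) =
        2 * e * fine (@lebesgue_measure R `]0, 1[) by exact: Rintegral_cst.
      by rewrite lebesgue_measure_itv /= lte_fin ltr01 /= subr0 mulr1.
    apply: le_Rintegral => // t Dt; rewrite leNgt; apply/negP => lt.
    by apply: noy; exists t => //; exact: ltW.
  have -> : \int[@lebesgue_measure R]_(t in `]0, 1[) `|E t| =
      \int[@lebesgue_measure R]_(t in `]0, 1[) `|g t|.
    rewrite /Rintegral; congr fine; apply: ae_eq_integral => //.
    - by have /integrableP[mE _] := iE.
    - by have /integrableP[mg _] := integrable_abse intg.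
    - have H : {ae @lebesgue_measure R, forall t, `]0, 1[%classic t ->
          (`|E t|)%:E = (`|g t|)%:E}.
        by apply: (ae_imp gE) => t Ht /Ht ->.
      exact: H.
  lra.
have y01 : 0 <= y <= 1.
  by move: Dy; rewrite /= in_itv /= => /andP[y0 y1]; rewrite !ltW.
have := le_trans (HE y x y01 x01) g1e.
have := ler_normD (E x - E y) (E y); rewrite subrK; lra.
Qed.

(** The one-dimensional Sobolev embedding of H^(r + 1) in C^r, with constant 3. Continuity of f
    upgrades the almost everywhere equality to all of [0, 1]. *)
Lemma weak_derivs_C (R : realType) (r : nat) (f : R -> R) (g : nat -> R -> R) :
  cont01 f -> weak_derivs r.+1 f g ->
  exists G : nat -> R -> R,
  [/\ forall k, continuous (G k),
      forall k, (k < r)%N -> forall x : R, 0 <= x <= 1 -> is_derive x 1 (G k) (G k.+1 x),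
      forall x, 0 <= x <= 1 -> f x = G 0 x
    & forall e, 0 < e -> (forall k, (k <= r.+1)%N ->
          (\int[@lebesgue_measure R]_(x in `]0%R, 1%R[) (g k x ^+ 2)%:E < (e ^+ 2)%:E)%E) ->
        forall k, (k <= r)%N -> forall x, 0 <= x <= 1 -> `|G k x| <= 3 * e].
Proof.
move=> cf [g0 sg wg]; have [G [cG dG aG bG]] := sobolev_C sg wg.
exists G; split => //.
  apply: ae_eq_cont01 => //; apply: (ae_imp (aG 0 isT)) => x Hx Dx.
  by rewrite -g0// Hx.
move=> e e0 ge k kr.
have kr1 : (k <= r.+1)%N by exact: leqW.
apply: (@sup_bound _ (g k) (g k.+1)) => //.
- exact: square_integrable_integrable (sg _ kr1).
- exact: aG.
- exact: Rintegral_norm_le e0 (sg _ kr1) (ge _ kr1).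
- exact: Rintegral_norm_le e0 (sg k.+1 kr) (ge k.+1 kr).
- exact: bG.
Qed.

Lemma Ck_cvg_family (R : realType) (k : nat) (F : nat -> option nat -> R -> R) :
  (forall i o, continuous (F i o)) ->
  (forall i o, (i < k)%N -> forall x : R, 0 <= x <= 1 ->
     is_derive x 1 (F i o) (F i.+1 o x)) ->
  (forall i, (i <= k)%N -> forall e, 0 < e -> exists N0 : nat, forall N, (N0 <= N)%N ->
        forall x, 0 <= x <= 1 -> `|F i (Some N) x - F i None x| < e) ->
  Ck_cvg k (F 0).
Proof.
elim: k F => [|k IH] F cF dF eF /=.
  split; [by move=> o x _; exact: cF|exact: eF|by []].
split; [by move=> o x _; exact: cF|exact: eF|].
exists (F 1) => [m x x01|]; first exact: dF.
apply: (IH (fun i => F i.+1)) => [i m|i m ik|i ik].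
- exact: cF.
- exact: dF.
- exact: eF.
Qed.

Lemma sobolev_norm_lt_each (R : realType) (r : nat) (g : nat -> R -> R) (e : R) :
  (\sum_(k < r.+1) \int[@lebesgue_measure R]_(x in `]0%R, 1%R[) (g k x ^+ 2)%:E
     < (e ^+ 2)%:E)%E ->
  forall k, (k <= r)%N ->
    (\int[@lebesgue_measure R]_(x in `]0%R, 1%R[) (g k x ^+ 2)%:E < (e ^+ 2)%:E)%E.
Proof.
move=> le k kr; apply: le_lt_trans le.
rewrite (bigD1 (Ordinal (kr : (k < r.+1)%N)))//= leeDl// sume_ge0// => i _.
by apply: integral_ge0 => x _; rewrite lee_fin sqr_ge0.
Qed.

(** The embedding is applied to the limit and to each difference, and F (Some N) is the sum of the
    two results; uniform convergence is then the estimate on the differences. F may differ from f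
    outside [0, 1], which is how it gets two-sided derivatives at 0 and 1. *)
Lemma sobolev_Ck_cvg (R : realType) (r : nat) (f : option nat -> R -> R) :
  (forall o, cont01 (f o)) -> sobolev r.+1 (f None) ->
  (forall N, sobolev_norm_lt r.+1 (fun x => f (Some N) x - f None x) (N.+1%:R^-1)) ->
  exists2 F, Ck_cvg r F & forall o x, 0 <= x <= 1 -> F o x = f o x.
Proof.
move=> cf [g wg] Hs.
have [G [cG dG fG _]] := weak_derivs_C (cf None) wg.
have /choice[E HE] : forall N, exists E : nat -> R -> R,
  [/\ forall k, continuous (E k),
      forall k, (k < r)%N -> forall x : R, 0 <= x <= 1 -> is_derive x 1 (E k) (E k.+1 x),
      forall x, 0 <= x <= 1 -> f (Some N) x - f None x = E 0 x
    & forall k, (k <= r)%N -> forall x, 0 <= x <= 1 -> `|E k x| <= 3 * N.+1%:R^-1].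
  move=> N; have [h wh hN] := Hs N.
  have [E [cE dE fE bE]] := weak_derivs_C (cont01B (cf (Some N)) (cf None)) wh.
  exists E; split => //; apply: bE; first by rewrite invr_gt0.
  exact: sobolev_norm_lt_each.
pose F (i : nat) (o : option nat) : R -> R :=
  if o is Some N then fun x => G i x + E N i x else G i.
exists (F 0).
  apply: Ck_cvg_family.
  - move=> i [N|] x; rewrite /F; last exact: cG.
    by apply: cvgD; [exact: cG|have [c _ _ _] := HE N; exact: c].
  - move=> i [N|] ir x x01; rewrite /F; last exact: dG.
    apply: is_deriveD; first exact: dG.
    by have [_ d _ _] := HE N; exact: d.
  - move=> i ir e e0.
    exists (Num.truncn (3 / e)).+1 => N N0 x x01; rewrite /F addrAC subrr add0r.
    have [_ _ _ b] := HE N; apply: (le_lt_trans (b i ir x x01)).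
    rewrite ltr_pdivrMr// mulrC -ltr_pdivrMr//.
    apply: (lt_trans (truncnS_gt _)).
    by rewrite ltr_nat ltnS.
case=> [N|] x x01; rewrite /F; last by rewrite fG.
have [_ _ h _] := HE N; by rewrite -h// -fG// addrC subrK.
Qed.

(** * Convergence with derivatives *)

Lemma Ck_cvg_leq (R : realType) (k m : nat) (F : option nat -> R -> R) :
  (m <= k)%N -> Ck_cvg k F -> Ck_cvg m F.
Proof.
elim: m k F => [|m IH] [|k] F //= mk [cF eF DF]; split => //.
by case: DF => DF dF kDF; exists DF => //; exact: (IH k).
Qed.

Lemma Ck_cvg_cst (R : realType) (k : nat) (c : R) : Ck_cvg k (fun _ _ => c).
Proof.
elim: k c => [|k IH] c /=; (split;
  [by move=> _ x _; exact: cvg_cst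
  |by move=> e e0; exists 0%N => N _ x _; rewrite subrr normr0|]) => //.
by exists (fun _ _ => 0) => // _ x _; exact: is_derive_cst.
Qed.

Lemma Ck_cvgD (R : realType) (k : nat) (F G : option nat -> R -> R) :
  Ck_cvg k F -> Ck_cvg k G -> Ck_cvg k (fun m x => F m x + G m x).
Proof.
elim: k F G => [|k IH] F G /= [cF eF DF] [cG eG DG]; (split;
  [by move=> m x x01; apply: cvgD; [exact: cF|exact: cG]
  |move=> e e0; have e20 : 0 < e / 2 by rewrite divr_gt0
  |]) => //; first 2 last.
- case: DF => DF dF kDF; case: DG => DG dG kDG.
  exists (fun m x => DF m x + DG m x); last exact: IH.
  by move=> m x x01; apply: is_deriveD; [exact: dF|exact: dG].
all: have [N1 H1] := eF _ e20; have [N2 H2] := eG _ e20.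
all: exists (maxn N1 N2) => N; rewrite geq_max => /andP[n1 n2] x x01.
all: rewrite opprD addrACA (le_lt_trans (ler_normD _ _))// (splitr e).
all: by rewrite ltrD ?H1 ?H2.
Qed.

Lemma bounded01 (R : realType) (f : R -> R) :
  (forall x : R, 0 <= x <= 1 -> {for x, continuous f}) ->
  exists2 M, 0 < M & forall x, 0 <= x <= 1 -> `|f x| <= M.
Proof.
move=> cf; have cw : {within `[0, 1], continuous f}.
  by apply: continuous_in_subspaceT => x /set_mem; rewrite /= in_itv /=; exact: cf.
have /compact_bounded[M [_ HM]] := continuous_compact cw (@segment_compact R 0 1).
exists (`|M| + 1); first by rewrite ltr_wpDl.
move=> x x01; apply: (HM (`|M| + 1)).
  by rewrite (le_lt_trans (ler_norm M))// ltrDl.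
by exists x => //; rewrite /= in_itv.
Qed.

Lemma Ck_cvgM (R : realType) (k : nat) (F G : option nat -> R -> R) :
  Ck_cvg k F -> Ck_cvg k G -> Ck_cvg k (fun m x => F m x * G m x).
Proof.
have conv (F' G' : option nat -> R -> R) :
    (forall m (x : R), 0 <= x <= 1 -> {for x, continuous (F' m)}) ->
    (forall m (x : R), 0 <= x <= 1 -> {for x, continuous (G' m)}) ->
    (forall e : R, 0 < e -> exists N0 : nat, forall N, (N0 <= N)%N ->
        forall x, 0 <= x <= 1 -> `|F' (Some N) x - F' None x| < e) ->
    (forall e : R, 0 < e -> exists N0 : nat, forall N, (N0 <= N)%N ->
        forall x, 0 <= x <= 1 -> `|G' (Some N) x - G' None x| < e) ->
    (forall e : R, 0 < e -> exists N0 : nat, forall N, (N0 <= N)%N ->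
        forall x, 0 <= x <= 1 ->
        `|F' (Some N) x * G' (Some N) x - F' None x * G' None x| < e).
  move=> cF cG eF eG e e0.
  have [A A0 HA] := bounded01 (cF None); have [B B0 HB] := bounded01 (cG None).
  (* The tolerances match f g - f0 g0 = (f - f0) g + f0 (g - g0); the threshold N3 keeps g within 1
     of g0, hence below B + 1. *)
  have d10 : 0 < e / (B + 1) / 2 by rewrite !divr_gt0// ltr_wpDl// ltW.
  have d20 : 0 < e / A / 2 by rewrite !divr_gt0.
  have [N1 H1] := eF _ d10; have [N2 H2] := eG _ d20; have [N3 H3] := eG _ ltr01.
  exists (maxn N1 (maxn N2 N3)) => N; rewrite !geq_max => /and3P[n1 n2 n3] x x01.
  move: (H1 N n1 x x01) (H2 N n2 x x01) (H3 N n3 x x01) (HA x x01) (HB x x01).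
  set f := F' _ _; set f0 := F' _ _; set g := G' _ _; set g0 := G' _ _.
  move=> h1 h2 h3 hA hB.
  have gB : `|g| <= B + 1.
    by rewrite -(subrK g0 g) addrC (le_trans (ler_normD _ _))// lerD// ltW.
  have -> : f * g - f0 * g0 = (f - f0) * g + f0 * (g - g0) by ring.
  rewrite (le_lt_trans (ler_normD _ _))// (splitr e) !normrM ltr_leD//.
    rewrite (le_lt_trans (ler_wpM2l _ gB))//.
    rewrite -ltr_pdivlMr; last by rewrite ltr_wpDl// ltW.
    by rewrite mulrAC.
  rewrite (le_trans (ler_wpM2r _ hA))//.
  rewrite mulrC -ler_pdivlMr// mulrAC ltW//.
elim: k F G => [|k IH] F G FK GK; move: (FK) (GK) => /= [cF eF DF] [cG eG DG]; (split;
  [by move=> m x x01; apply: cvgM; [exact: cF|exact: cG]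
  |exact: conv
  |]) => //.
case: DF => DF dF kDF; case: DG => DG dG kDG.
exists (fun m x => F m x * DG m x + G m x * DF m x).
  by move=> m x x01; apply: is_deriveM; [exact: dF|exact: dG].
by apply: Ck_cvgD; apply: IH => //; exact: (Ck_cvg_leq (leqnSn k)).
Qed.

Lemma Ck_cvg_ext (R : realType) (k : nat) (F G : option nat -> R -> R) :
  (forall m x, F m x = G m x) -> Ck_cvg k F -> Ck_cvg k G.
Proof. by move=> FG; have -> : F = G by (apply/funext => m; apply/funext => x; exact: FG). Qed.

Lemma Ck_cvg_sum (R : realType) (k : nat) (I : Type) (s : seq I) (P : pred I)
    (F : I -> option nat -> R -> R) :
  (forall i, P i -> Ck_cvg k (F i)) ->
  Ck_cvg k (fun m x => \sum_(i <- s | P i) F i m x).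
Proof.
move=> FK; elim: s => [|i s IH].
  by apply: Ck_cvg_ext (Ck_cvg_cst k 0) => m x; rewrite big_nil.
apply: (@Ck_cvg_ext _ _ (fun m x => (if P i then F i m x else 0) +
   \sum_(j <- s | P j) F j m x)).
  by move=> m x; rewrite big_cons; case: ifP => // _; rewrite add0r.
apply: Ck_cvgD => //; case E: (P i); [exact: FK|exact: Ck_cvg_cst].
Qed.

Lemma Ck_cvg_prod (R : realType) (k : nat) (I : Type) (s : seq I) (P : pred I)
    (F : I -> option nat -> R -> R) :
  (forall i, P i -> Ck_cvg k (F i)) ->
  Ck_cvg k (fun m x => \prod_(i <- s | P i) F i m x).
Proof.
move=> FK; elim: s => [|i s IH].
  by apply: Ck_cvg_ext (Ck_cvg_cst k 1) => m x; rewrite big_nil.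
apply: (@Ck_cvg_ext _ _ (fun m x => (if P i then F i m x else 1) *
   \prod_(j <- s | P j) F j m x)).
  by move=> m x; rewrite big_cons; case: ifP => // _; rewrite mul1r.
apply: Ck_cvgM => //; case E: (P i); [exact: FK|exact: Ck_cvg_cst].
Qed.

Lemma Ck_cvg_det (R : realType) (k n : nat) (M : option nat -> R -> 'M[R]_n) :
  (forall i j, Ck_cvg k (fun m x => M m x i j)) ->
  Ck_cvg k (fun m x => \det (M m x)).
Proof.
move=> MK; apply: Ck_cvg_sum => s _; apply: Ck_cvgM; first exact: Ck_cvg_cst.
by apply: Ck_cvg_prod => i _; exact: MK.
Qed.

Lemma Ck_cvg_derivs (R : realType) (k : nat) (F : option nat -> R -> R) :
  Ck_cvg k F -> exists D : nat -> option nat -> R -> R,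
  [/\ D 0 = F,
      forall i m (x : R), (i <= k)%N -> 0 <= x <= 1 -> {for x, continuous (D i m)},
      forall i m (x : R), (i < k)%N -> 0 <= x <= 1 ->
        is_derive x 1 (D i m) (D i.+1 m x)
    & forall i e, (i <= k)%N -> 0 < e -> exists N0 : nat, forall N, (N0 <= N)%N ->
        forall x, 0 <= x <= 1 -> `|D i (Some N) x - D i None x| < e].
Proof.
elim: k F => [|k IH] F /= [cF eF DF].
  by exists (fun _ => F); split => // [i m x _|i e _]; [exact: cF|exact: eF].
case: DF => DF dF /IH[D [D0 cD dD eD]].
exists (fun i => if i is i'.+1 then D i' else F); split => //.
- by case=> [|i] m x ik; [exact: cF|exact: cD].
- by case=> [|i] m x ik; [rewrite D0; exact: dF|exact: dD].
- by case=> [|i] e ik; [exact: eF|exact: eD].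
Qed.

(** * Leading terms *)

(* f(t) = (c + o(1)) (t - t0)^h as t -> t0 in [0, 1]; f(t0) is irrelevant. *)
Definition asymp (R : realType) (f : R -> R) (t0 : R) (h : nat) (c : R) :=
  forall e, 0 < e -> exists2 d, 0 < d & forall t, 0 <= t <= 1 ->
    0 < `|t - t0| < d -> `|f t - c * (t - t0) ^+ h| <= e * `|t - t0| ^+ h.

Section asymp.
Variables (R : realType) (t0 : R).
Implicit Types (f g : R -> R) (h k : nat) (a b c : R).

Lemma asymp_cst c : asymp (fun _ => c) t0 0 c.
Proof.
move=> e e0; exists 1 => // t _ _.
by rewrite !expr0 !mulr1 subrr normr0 ltW.
Qed.

Lemma asymp_ext f g h c : (forall t, 0 <= t <= 1 -> f t = g t) ->
  asymp f t0 h c -> asymp g t0 h c.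
Proof.
move=> fg af e e0; have [d d0 H] := af e e0; exists d => // t t01 td.
by rewrite -fg// H.
Qed.

Lemma asympD f g h a b : asymp f t0 h a -> asymp g t0 h b ->
  asymp (fun t => f t + g t) t0 h (a + b).
Proof.
move=> af ag e e0; have e20 : 0 < e / 2 by rewrite divr_gt0.
have [d1 d10 H1] := af _ e20; have [d2 d20 H2] := ag _ e20.
exists (Num.min d1 d2) => [|t t01]; first by rewrite lt_min d10.
rewrite lt_min => /andP[tt /andP[td1 td2]].
rewrite mulrDl opprD addrACA (le_trans (ler_normD _ _))//.
by rewrite (splitr e) mulrDl lerD ?H1 ?H2// tt.
Qed.

Lemma asymp_bound f h c : asymp f t0 h c ->
  exists2 C, 0 < C & exists2 d, 0 < d & forall t, 0 <= t <= 1 ->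
    0 < `|t - t0| < d -> `|f t| <= C * `|t - t0| ^+ h.
Proof.
move=> /(_ 1 ltr01)[d d0 H]; exists (1 + `|c|); first by rewrite ltr_pwDl.
exists d => // t t01 td; rewrite mulrDl.
rewrite -[X in `|X|](subrK (c * (t - t0) ^+ h)) (le_trans (ler_normD _ _))//.
by rewrite lerD// ?H// normrM normrX.
Qed.

Lemma asympM f g h k a b : asymp f t0 h a -> asymp g t0 k b ->
  asymp (fun t => f t * g t) t0 (h + k) (a * b).
Proof.
move=> af ag e e0; have [C C0 [d3 d30 H3]] := asymp_bound ag.
have d1p : 0 < e / 2 / C by rewrite !divr_gt0.
have d2p : 0 < e / 2 / (`|a| + 1) by rewrite !divr_gt0// ltr_wpDl.
have [d1 d10 H1] := af _ d1p; have [d2 d20 H2] := ag _ d2p.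
exists (Num.min d1 (Num.min d2 d3)) => [|t t01]; first by rewrite !lt_min d10 d20.
rewrite !lt_min => /andP[tt /and3P[td1 td2 td3]].
move: (H1 t t01) (H2 t t01) (H3 t t01); rewrite tt td1 td2 td3.
move=> /(_ isT) h1 /(_ isT) h2 /(_ isT) h3.
have -> : f t * g t - a * b * (t - t0) ^+ (h + k) =
  (f t - a * (t - t0) ^+ h) * g t + a * (t - t0) ^+ h * (g t - b * (t - t0) ^+ k).
  by rewrite exprD; ring.
rewrite (le_trans (ler_normD _ _))// !normrM normrX exprD.
set x := `|t - t0| in h1 h2 h3 *.
have x0 : 0 <= x by exact: normr_ge0.
have xh : 0 <= x ^+ h by rewrite exprn_ge0.
have xk : 0 <= x ^+ k by rewrite exprn_ge0.
have -> : e * (x ^+ h * x ^+ k) = e / 2 / C * x ^+ h * (C * x ^+ k) +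
   (`|a| + 1) * x ^+ h * (e / 2 / (`|a| + 1) * x ^+ k).
  have a1 : `|a| + 1 != 0 by rewrite gt_eqF// ltr_wpDl.
  have c1 : C != 0 by rewrite gt_eqF.
  by field; rewrite a1 c1.
rewrite lerD//; first by rewrite ler_pM.
apply: ler_pM => //; first by rewrite mulr_ge0.
by rewrite ler_wpM2r// lerDl.
Qed.

Lemma asymp_lt f h k c : (k < h)%N -> asymp f t0 h c -> asymp f t0 k 0.
Proof.
move=> kh af e e0; have [C C0 [d d0 H]] := asymp_bound af.
exists (Num.min d (Num.min 1 (e / C))) => [|t t01].
  by rewrite !lt_min d0 ltr01 divr_gt0.
rewrite !lt_min => /andP[tt /and3P[td t1 te]].
rewrite mul0r subr0; apply: (le_trans (H t t01 _)); first by rewrite tt.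
rewrite -(subnK kh) addnS -addSn exprD mulrA ler_wpM2r ?exprn_ge0//.
rewrite mulrC -ler_pdivlMr//; apply: le_trans (ltW te).
by rewrite exprS ler_piMr// exprn_ile1// ltW.
Qed.

Lemma asymp_pow h : asymp (fun t => (t - t0) ^+ h) t0 h 1.
Proof.
move=> e e0; exists 1 => // t _ _.
by rewrite mul1r subrr normr0 mulr_ge0// ?ltW// exprn_gt0.
Qed.

Lemma asympZ f h a c : asymp f t0 h a -> asymp (fun t => c * f t) t0 h (c * a).
Proof. exact: asympM (asymp_cst c). Qed.

Lemma asymp_sum (I : Type) (s : seq I) (P : pred I) (F : I -> R -> R) h (a : I -> R) :
  (forall i, P i -> asymp (F i) t0 h (a i)) ->
  asymp (fun t => \sum_(i <- s | P i) F i t) t0 h (\sum_(i <- s | P i) a i).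
Proof.
move=> H; elim: s => [|i s IH].
  apply: (@asymp_ext (fun t => 0 * (t - t0) ^+ h)).
    by move=> t _; rewrite big_nil mul0r.
  by rewrite big_nil; have := asympZ 0 (asymp_pow h); rewrite mul0r.
rewrite big_cons; case E: (P i).
  apply: (@asymp_ext (fun t => F i t + \sum_(j <- s | P j) F j t)).
    by move=> t _; rewrite big_cons E.
  by apply: asympD => //; exact: H.
by apply: asymp_ext IH => t _; rewrite big_cons E.
Qed.

Lemma asymp_prod (I : Type) (s : seq I) (F : I -> R -> R) (h : I -> nat) (a : I -> R) :
  (forall i, asymp (F i) t0 (h i) (a i)) ->
  asymp (fun t => \prod_(i <- s) F i t) t0 (\sum_(i <- s) h i) (\prod_(i <- s) a i).
Proof.
move=> H; elim: s => [|i s IH].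
  rewrite !big_nil; apply: (@asymp_ext (fun=> 1)); last exact: asymp_cst.
  by move=> t _; rewrite big_nil.
rewrite !big_cons; apply: (@asymp_ext (fun t => F i t * \prod_(j <- s) F j t)).
  by move=> t _; rewrite big_cons.
exact: asympM.
Qed.

Lemma asymp_continuous f : {for t0, continuous f} -> asymp f t0 0 (f t0).
Proof.
move=> /cvgrPdist_lt cf e e0; have /nbhs_ballP[d /= d0 H] := cf e e0.
exists d => // t _ /andP[_ td]; rewrite !expr0 !mulr1 distrC ltW//.
by apply: H; rewrite /ball /= distrC.
Qed.

Lemma asymp_cancel_pow f s h c :
  asymp (fun t => (t - t0) ^+ s * f t) t0 (s + h) c -> asymp f t0 h c.
Proof.
move=> af e e0; have [d d0 H] := af e e0; exists d => // t t01 td.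
have := H t t01 td; rewrite exprD (exprD `|_|).
rewrite mulrCA -mulrBr normrM normrX mulrCA ler_pM2l// exprn_gt0//.
by case/andP: td.
Qed.

Hypothesis t0_01 : 0 <= t0 <= 1.

Lemma point_near (d : R) : 0 < d -> exists2 t, 0 <= t <= 1 & 0 < `|t - t0| < d.
Proof.
move: t0_01 => /andP[x0 x1] d0.
(* A step of length at most 1 / 2, taken away from the nearer end, stays in [0, 1]. *)
pose m := Num.min d 1 / 2.
have m0 : 0 < m by rewrite /m divr_gt0// lt_min d0 ltr01.
have md : m < d.
  have : Num.min d 1 <= d by rewrite ge_min lexx.
  rewrite /m; move: d0; lra.
have m1 : m <= 1 / 2 by rewrite /m ler_pM2r ?invr_gt0// ge_min lexx orbT.
clearbody m.
have [x2|x2] := lerP t0 (1 / 2).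
  exists (t0 + m); first by apply/andP; split; lra.
  by rewrite addrAC subrr add0r gtr0_norm// m0.
exists (t0 - m); first by apply/andP; split; lra.
by rewrite addrAC subrr add0r normrN gtr0_norm// m0.
Qed.

Lemma asymp_unique f h a b : asymp f t0 h a -> asymp f t0 h b -> a = b.
Proof.
move=> af bf; apply/eqP; rewrite -subr_eq0 -normr_le0.
apply/ler_addgt0Pr => e e0; rewrite add0r.
have e20 : 0 < e / 2 by rewrite divr_gt0.
have [d1 d10 H1] := af _ e20; have [d2 d20 H2] := bf _ e20.
have [|t t01] := @point_near (Num.min d1 d2); first by rewrite lt_min d10.
rewrite lt_min => /andP[tt /andP[td1 td2]].
have := H1 t t01; rewrite tt td1 => /(_ isT) h1.
have := H2 t t01; rewrite tt td2 => /(_ isT) h2.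
have x0 : 0 < `|t - t0| ^+ h by rewrite exprn_gt0.
rewrite -(ler_pM2r x0) -normrX -normrM normrX.
have -> : (a - b) * (t - t0) ^+ h = (f t - b * (t - t0) ^+ h) - (f t - a * (t - t0) ^+ h).
  by ring.
by rewrite (le_trans (ler_normB _ _))// {1}(splitr e) [X in _ <= X]mulrDl lerD.
Qed.

End asymp.

(** * Counting zeros with multiplicity *)

Lemma is_derive_continuous (R : realType) (f : R -> R) (x d : R) :
  is_derive x 1 f d -> {for x, continuous f}.
Proof.
by move=> [df _]; apply: differentiable_continuous; apply/derivable1_diffP.
Qed.

Lemma MVT01 (R : realType) (f f' : R -> R) (x y : R) :
  (forall t : R, 0 <= t <= 1 -> is_derive t 1 f (f' t)) ->
  0 <= x <= 1 -> 0 <= y <= 1 -> x < y ->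
  exists2 z, x < z < y & f y - f x = f' z * (y - x).
Proof.
move=> df /andP[x0 x1] /andP[y0 y1] xy.
have [||z zxy fz] := @MVT R f f' x y xy.
- move=> t; rewrite in_itv /= => /andP[t1 t2]; apply: df.
  by rewrite (le_trans x0 (ltW t1)) (le_trans (ltW t2) y1).
- apply: continuous_in_subspaceT => z /set_mem; rewrite /= in_itv /= => /andP[t1 t2].
  apply: (@is_derive_continuous _ _ _ (f' z)); apply: df.
  by rewrite (le_trans x0 t1) (le_trans t2 y1).
- by exists z => //; move: zxy; rewrite in_itv.
Qed.

(** The mean value theorem for f - c (t - t0)^(h + 1) / (h + 1): its derivative f' - c (t - t0)^h is
    at most e |z - t0|^h at a point z nearer to t0 than t is. *)
Lemma asymp_primitive (R : realType) (f f' : R -> R) (t0 : R) (h : nat) (c : R) :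
  0 <= t0 <= 1 -> (forall t : R, 0 <= t <= 1 -> is_derive t 1 f (f' t)) ->
  f t0 = 0 -> asymp f' t0 h c -> asymp f t0 h.+1 (c / h.+1%:R).
Proof.
move=> t001 df f0 af e e0; have [d d0 H] := af e e0; exists d => // t t01 /andP[tt td].
pose a := c / h.+1%:R.
have dp (x : R) : is_derive x 1 (fun s : R => s - t0) 1.
  by apply: is_derive_eq; rewrite subr0.
have dg (x : R) : 0 <= x <= 1 ->
    is_derive x 1 (fun s => f s - a * (s - t0) ^+ h.+1) (f' x - c * (x - t0) ^+ h).
  move=> /df dfx; have := is_deriveX h.+1 (dp x); rewrite exprfctE => dpx.
  have dax := is_deriveZ a dpx.
  have := is_deriveB dfx dax; rewrite /GRing.scale /=.
  congr (is_derive _ _ _ _); rewrite /a mulr1 mulrA.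
  by congr (_ - _ * _); rewrite mulfVK// pnatr_eq0.
have g0 : f t0 - a * (t0 - t0) ^+ h.+1 = 0 by rewrite f0 subrr expr0n mulr0 subrr.
have key z : 0 <= z <= 1 -> 0 < `|z - t0| -> `|z - t0| < `|t - t0| ->
    `|f' z - c * (z - t0) ^+ h| * `|t - t0| <= e * `|t - t0| ^+ h.+1.
  move=> z01 z0 zt; rewrite exprSr mulrA ler_wpM2r//.
  apply: (@le_trans _ _ (e * `|z - t0| ^+ h)).
    by apply: H => //; rewrite z0 (lt_trans zt).
  by rewrite ler_pM2l// lerXn2r ?nnegrE// ltW.
move: tt; rewrite normr_gt0 subr_eq0 neq_lt => /orP[lt|gt].
- have [z /andP[tz zt0]] := MVT01 dg t01 t001 lt.
  rewrite g0 sub0r => gz.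
  rewrite -normrN gz normrM [`|t0 - t|]distrC; apply: key.
  + move: t01 t001 => /andP[? ?] /andP[? ?]; apply/andP; split; lra.
  + by rewrite normr_gt0 subr_eq0 lt_eqF.
  + by rewrite !ltr0_norm ?subr_lt0// ltrN2 ltrD2r.
- have [z /andP[tz zt0]] := MVT01 dg t001 t01 gt.
  rewrite g0 subr0 => gz.
  rewrite gz normrM; apply: key.
  + move: t01 t001 => /andP[? ?] /andP[? ?]; apply/andP; split; lra.
  + by rewrite normr_gt0 subr_eq0 gt_eqF.
  + by rewrite !gtr0_norm ?subr_gt0// ltrD2r.
Qed.

Lemma asymp_taylor (R : realType) (k : nat) (D : nat -> R -> R) (t0 : R) :
  0 <= t0 <= 1 ->
  (forall (x : R), 0 <= x <= 1 -> {for x, continuous (D k)}) ->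
  (forall i (x : R), (i < k)%N -> 0 <= x <= 1 -> is_derive x 1 (D i) (D i.+1 x)) ->
  (forall i, (i < k)%N -> D i t0 = 0) ->
  asymp (D 0) t0 k (D k t0 / k`!%:R).
Proof.
move=> t01; elim: k D => [|k IH] D cD dD D0.
  by rewrite fact0 divr1; apply: asymp_continuous; exact: cD.
have := IH (fun i => D i.+1) cD _ _.
move=> /(_ (fun i x ik => dD i.+1 x ik)) /(_ (fun i ik => D0 i.+1 ik)) a1.
have := asymp_primitive t01 (fun x => dD 0 x isT) (D0 0 isT) a1.
by rewrite factS natrM invfM mulrA mulrAC.
Qed.

(** The passage from leading terms to derivatives. If the derivatives below order i vanish at t0,
    Taylor's formula gives a leading term of order i; for i < h its coefficient must be 0, because
    leading coefficients are unique. *)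
Lemma asymp_derivs (R : realType) (k h : nat) (D : nat -> R -> R) (t0 l : R) :
  0 <= t0 <= 1 -> (h <= k)%N ->
  (forall i (x : R), (i <= k)%N -> 0 <= x <= 1 -> {for x, continuous (D i)}) ->
  (forall i (x : R), (i < k)%N -> 0 <= x <= 1 -> is_derive x 1 (D i) (D i.+1 x)) ->
  asymp (D 0) t0 h l ->
  (forall i, (i < h)%N -> D i t0 = 0) /\ D h t0 = l * h`!%:R.
Proof.
move=> t01 hk cD dD al.
have tay j : (j <= h)%N -> (forall i, (i < j)%N -> D i t0 = 0) ->
    asymp (D 0) t0 j (D j t0 / j`!%:R).
  move=> jh D0; apply: asymp_taylor => //.
    by move=> x; apply: cD; exact: leq_trans hk.
  by move=> i x ij; apply: dD; rewrite (leq_trans ij)// (leq_trans jh).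
have f0 j : j`!%:R != 0 :> R by rewrite pnatr_eq0 -lt0n fact_gt0.
have D0 : forall i, (i < h)%N -> D i t0 = 0.
  elim/ltn_ind => i IH ih.
  have ai := tay i (ltnW ih) (fun j ji => IH j ji (ltn_trans ji ih)).
  have := asymp_unique t01 ai (asymp_lt ih al).
  by move/eqP; rewrite mulf_eq0 invr_eq0 (negbTE (f0 i)) orbF => /eqP.
split => //; rewrite -(asymp_unique t01 (tay h (leqnn h) D0) al).
by rewrite mulfVK.
Qed.

(** * Rolle's theorem for zeros with multiplicity *)

Section rolle.
Variable R : realType.
Implicit Types (D : nat -> R -> R) (L : seq (R * nat)).

Definition vanish D L := forall p, p \in L -> forall i, (i < p.2)%N -> D i p.1 = 0.

Lemma rolle_step D x m L : 0 <= x ->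
  (forall y : R, 0 <= y <= 1 -> is_derive y 1 (D 0) (D 1 y)) ->
  all (fun p => 0 < p.2)%N ((x, m) :: L) ->
  path <%R x [seq p.1 | p <- L] -> all (fun p => p.1 <= 1) ((x, m) :: L) ->
  vanish D ((x, m) :: L) ->
  exists L', [/\ path <%R x [seq p.1 | p <- L'],
    all (fun p => p.1 <= last x [seq p.1 | p <- L]) L',
    vanish (fun i => D i.+1) ((x, m.-1) :: L') &
    ((m + \sum_(p <- L) p.2) = (m.-1 + \sum_(p <- L') p.2).+1)%N].
Proof.
move=> x0 dD; elim: L x m x0 => [|[y m'] L IH] x m x0 /=.
  move=> /andP[m0 _] _ _ vD; exists [::]; split => //.
    move=> p; rewrite inE => /eqP -> i /= im.
    have -> // := vD (x, m); [by rewrite inE|].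
    by rewrite /= -(prednK m0).
  by rewrite !big_nil !addn0 prednK.
move=> /and3P[m0 m'0 mL] /andP[xy yL] /and3P[x1 y1 L1] vD.
have y0 : 0 <= y by rewrite (le_trans x0)// ltW.
have [||||L' [yL' L'1 vL' sL]] := IH y m' y0.
- by rewrite /= m'0.
- by [].
- by rewrite /= y1.
- by move=> p pL; apply: vD; rewrite inE pL orbT.
have Dx : D 0 x = 0 by apply: (vD (x, m)) => //; rewrite inE eqxx.
have Dy : D 0 y = 0 by apply: (vD (y, m')) => //; rewrite !inE eqxx orbT.
have [z /andP[xz zy] Hz] : exists2 z, x < z < y & D 0 y - D 0 x = D 1 z * (y - x).
  by apply: MVT01 => //; rewrite ?x0 ?x1 ?y0 ?y1.
have Dz : D 1 z = 0.
  move: Hz; rewrite Dx Dy subrr => /esym/eqP; rewrite mulf_eq0 subr_eq0.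
  by rewrite (gt_eqF xy) orbF => /eqP.
exists ((z, 1%N) :: (y, m'.-1) :: L'); split => /=.
- by rewrite xz zy.
- have yl : y <= last y [seq p.1 | p <- L].
    by have := order_path_min lt_trans yL; case/lastP: (map _ L) => //= s a;
      rewrite last_rcons all_rcons => /andP[/ltW].
  by rewrite yl (le_trans (ltW zy) yl).
- move=> p; rewrite !inE => /or3P[/eqP->|/eqP->|pL'] i /= im.
  + by apply: (vD (x, m)); rewrite ?inE ?eqxx//= -(prednK m0).
  + by move: im; case: i.
  + by apply: vL'; rewrite // inE.
- by rewrite !big_cons /= sL -{1}(prednK m0) addSn add1n.
Qed.

Lemma rolle_blocks k D L (a b : R) : 0 <= a -> b <= 1 ->
  (forall i (x : R), (i < k)%N -> 0 <= x <= 1 -> is_derive x 1 (D i) (D i.+1 x)) ->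
  sorted <%R [seq p.1 | p <- L] -> all (fun p => a <= p.1 <= b) L ->
  vanish D L -> (k < \sum_(p <- L) p.2)%N ->
  exists2 z, a <= z <= b & D k z = 0.
Proof.
move=> a0 b1; elim: k D L => [|k IH] D L dD sL abL vD kL.
  have [p pL p0] : exists2 p, p \in L & (0 < p.2)%N.
    apply/hasP; apply: contraLR kL => /hasPn H; rewrite -leqNgt leqn0.
    rewrite big_seq big1// => p /H; rewrite -leqNgt leqn0 => /eqP //.
  exists p.1; first exact: (allP abL).
  exact: vD.
(* A pair with multiplicity 0 asserts no zero, so it has to go before Rolle's theorem is applied
   between neighbours. *)
pose L1 := [seq p <- L | (0 < p.2)%N].
have sL1 : sorted <%R [seq p.1 | p <- L1].
  apply: (subseq_sorted lt_trans _ sL); apply: map_subseq; exact: filter_subseq.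
have abL1 : all (fun p => a <= p.1 <= b) L1.
  by apply/allP => p; rewrite mem_filter => /andP[_ /(allP abL)].
have posL1 : all (fun p => 0 < p.2)%N L1 by exact: filter_all.
have vL1 : vanish D L1 by move=> p; rewrite mem_filter => /andP[_]; exact: vD.
have kL1 : (k.+1 < \sum_(p <- L1) p.2)%N.
  apply: leq_trans kL _; rewrite big_filter [X in (_ <= X)%N]big_mkcond /=.
  by apply: leq_sum => p _; case: (p.2).
case: L1 sL1 abL1 posL1 vL1 kL1 => [|[x m] L1]; first by rewrite big_nil.
move=> /= sL1 /andP[/andP[ax xb] abL1] posL1 vL1; rewrite big_cons => kL1.
have [||||L' [xL' lL' vL' sum]] := @rolle_step D x m L1 (le_trans a0 ax) (fun y => dD 0 y isT).
- exact: posL1.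
- exact: sL1.
- by rewrite /= (le_trans xb b1); apply/allP => p /(allP abL1) /andP[_] /le_trans; apply.
- exact: vL1.
apply: (IH (fun i => D i.+1) ((x, m.-1) :: L')) => //.
- by move=> i y ik; exact: (dD i.+1 y ik).
- rewrite /= ax xb; apply/allP => p pL'.
  have := order_path_min lt_trans xL' => /allP /(_ p.1 (map_f _ pL')) /ltW xp.
  rewrite (le_trans ax xp) (le_trans (allP lL' _ pL'))//.
  case/lastP: L1 abL1 {sL1 posL1 vL1 kL1 lL' sum} => //= s q.
  by rewrite map_rcons last_rcons all_rcons => /andP[/andP[]].
- by rewrite big_cons /= -ltnS -sum.
Qed.

End rolle.

(* The coefficient l may be 0: p.2 is only a lower bound for the order of vanishing of
   f at p.1. *)
Definition zeros (R : realType) (k : nat) (f : R -> R) (L : seq (R * nat)) :=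
  [/\ sorted <%R [seq p.1 | p <- L], all (fun p => 0 <= p.1 <= 1) L
    & forall p, p \in L -> (p.2 <= k)%N /\ exists l, asymp f p.1 p.2 l].

Lemma zeros_filter (R : realType) (k : nat) (f : R -> R) (P : pred (R * nat)) L :
  zeros k f L -> zeros k f [seq p <- L | P p].
Proof.
move=> [sL aL oL]; split.
- by apply: (subseq_sorted lt_trans _ sL); apply: map_subseq; exact: filter_subseq.
- by apply/allP => p; rewrite mem_filter => /andP[_ /(allP aL)].
- by move=> p; rewrite mem_filter => /andP[_]; exact: oL.
Qed.

(** The derivative of order h of the limit is l h! at t0, hence nonzero. It stays away from 0 near
    t0, and so does that of F (Some N) for large N, by uniform convergence. More than h zeros near
    t0 would force it to vanish there. *)
Lemma local_count (R : realType) (k h : nat) (F : option nat -> R -> R) (t0 l : R) :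
  Ck_cvg k F -> (h <= k)%N -> 0 <= t0 <= 1 -> l != 0 -> asymp (F None) t0 h l ->
  exists2 d, 0 < d & exists N0 : nat, forall N, (N0 <= N)%N -> forall L,
    zeros k (F (Some N)) L -> all (fun p => `|p.1 - t0| < d) L ->
    (\sum_(p <- L) p.2 <= h)%N.
Proof.
move=> /Ck_cvg_derivs[D [<- cD dD eD]] hk t001 l0 al.
have [_ Dh] := asymp_derivs t001 hk (fun i x => cD i None x) (fun i x => dD i None x) al.
set v := D h None t0 in Dh.
have v0 : v != 0 by rewrite Dh mulf_neq0// pnatr_eq0 -lt0n fact_gt0.
have v2 : 0 < `|v| / 2 by rewrite divr_gt0// normr_gt0.
have /cvgrPdist_lt/(_ _ v2)/nbhs_ballP[d /= d0 Hd] := cD h None t0 hk t001.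
have [N0 HN] := eD h _ hk v2.
(* Rolle's theorem yields a point of the closed interval of radius d / 2, which lies in the open
   ball of radius d. *)
exists (d / 2); first by rewrite divr_gt0.
exists N0 => N N0N L [sL aL oL] dL.
rewrite leqNgt; apply/negP => hL.
pose a := Num.max 0 (t0 - d / 2); pose b := Num.min 1 (t0 + d / 2).
have [|||||z /andP[az zb]] := @rolle_blocks R h (fun i => D i (Some N)) L a b _ _ _ sL _ _ hL.
- by rewrite /a le_max lexx.
- by rewrite /b ge_min lexx.
- by move=> i x ih; apply: dD; exact: leq_trans hk.
- apply/allP => p pL; have /andP[p0 p1] := allP aL _ pL.
  have := allP dL _ pL; rewrite ltr_distl => /andP[h1 h2].
  by rewrite /a /b ge_max le_min p0 p1 /= (ltW h1) (ltW h2).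
- move=> p pL i ip; have [pk [l' al']] := oL p pL.
  have p01 := allP aL _ pL.
  have [H _] := asymp_derivs p01 pk (fun i x => cD i (Some N) x) (fun i x => dD i (Some N) x) al'.
  exact: H.
- move: az zb; rewrite /a /b ge_max le_min => /andP[z0 tz] /andP[z1 zt] Dz.
  have z01 : 0 <= z <= 1 by rewrite z0.
  have zd : `|t0 - z| < d by rewrite ltr_distl; apply/andP; split; lra.
  have h1 := Hd _ zd; have h2 := HN N N0N z z01.
  move: h1 h2; rewrite Dz sub0r normrN -/v => h1 h2.
  have := ler_normD (v - D h None z) (D h None z); rewrite subrK; lra.
Qed.

(** Finitely many of the neighbourhoods of [local_count] cover [0, 1]. Every listed zero lies in at
    least one of them, so the total is at most the sum of the local bounds h t over the centres, and
    centres outside S contribute 0. *)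
Lemma global_count (R : realType) (k : nat) (F : option nat -> R -> R)
    (h : R -> nat) (S : seq R) :
  Ck_cvg k F -> uniq S ->
  (forall t, 0 <= t <= 1 -> (h t <= k)%N /\ exists2 l, l != 0 & asymp (F None) t (h t) l) ->
  (forall t, 0 <= t <= 1 -> t \notin S -> h t = 0%N) ->
  exists N : nat, forall L, zeros k (F (Some N)) L ->
    (\sum_(p <- L) p.2 <= \sum_(t <- S) h t)%N.
Proof.
move=> FK uS hF hS.
have loc (t : R) : exists dN : R * nat, 0 < dN.1 /\ (0 <= t <= 1 ->
    forall N, (dN.2 <= N)%N -> forall L, zeros k (F (Some N)) L ->
    all (fun p => `|p.1 - t| < dN.1) L -> (\sum_(p <- L) p.2 <= h t)%N).
  (* The pair (1, 0) is a dummy value: no cover centre lies outside [0, 1]. *)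
  have [t01|t01] := boolP (0 <= t <= 1); last by exists (1, 0%N).
  have [hk [l l0 al]] := hF t t01.
  by have [d d0 [N0 H]] := local_count FK hk t01 l0 al; exists (d, N0).
have [dN HdN] := choice loc.
have [D [uD D01 cov]] : exists D : seq R, [/\ uniq D, forall t, t \in D -> 0 <= t <= 1 &
    forall p, 0 <= p <= 1 -> exists2 t, t \in D & `|p - t| < (dN t).1].
  have := @segment_compact R 0 1; rewrite compact_cover.
  move=> /(_ R [set t | 0 <= t <= 1] (fun t => ball t (dN t).1)) [].
  - by move=> t _; exact: ball_open.
  - move=> t; rewrite /= in_itv /= => t01; exists t => //.
    by apply: ballxx; exact: (HdN t).1.
  move=> D D01 cov; exists (finmap.enum_fset D); split.
  - exact: finmap.fset_uniq.
  - by move=> t tD; have := D01 t tD; rewrite inE.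
  - move=> p p01; have [|t /= tD pt] := cov p; first by rewrite /= in_itv.
    by exists t => //; move: pt; rewrite /ball /= distrC.
exists (\max_(t <- D) (dN t).2)%N => L zL.
set N := (\max_(t <- D) _)%N in zL.
have step1 : (\sum_(p <- L) p.2 <=
    \sum_(t <- D) \sum_(p <- L | (`|p.1 - t| < (dN t).1)%R) p.2)%N.
  rewrite (exchange_big_dep xpredT) //= big_seq [X in (_ <= X)%N]big_seq.
  apply: leq_sum => p pL; have [_ /allP/(_ _ pL) p01 _] := zL.
  have [t tD pt] := cov _ p01.
  by rewrite big_mkcond (big_rem t) //= pt leq_addr.
apply: (leq_trans step1).
apply: (@leq_trans (\sum_(t <- D) h t)%N).
  rewrite big_seq [X in (_ <= X)%N]big_seq; apply: leq_sum => t tD.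
  rewrite -big_filter; apply: ((HdN t).2 _ N).
  - exact: D01.
  - by rewrite /N (big_rem t)//= leq_maxl.
  - exact: zeros_filter.
  - exact: filter_all.
rewrite (bigID (fun t => t \in S)) /= [X in (_ + X)%N]big1_seq ?addn0; last first.
  by move=> t /andP[tS tD]; apply: hS => //; exact: D01.
rewrite -big_filter.
apply: uniq_sub_le_big => //.
- by move=> x y; exact: leq_addr.
- by rewrite filter_uniq.
- by move=> t; rewrite mem_filter => /andP[].
Qed.

(** * Combinatorics of multiplicities *)

(** After sorting, the entry at index i of a list of distinct natural numbers is at least i. *)
Lemma sum_iota_le (s : seq nat) : uniq s -> (\sum_(i < size s) i <= \sum_(x <- s) x)%N.
Proof.
move=> us; rewrite -(perm_big _ (permEl (perm_sort leq s))) /=.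
have ss : sorted ltn (sort leq s).
  by rewrite ltn_sorted_uniq_leq sort_uniq us (sort_sorted leq_total).
rewrite -(size_sort leq s); move: (sort leq s) ss => {us}s ss.
rewrite (big_nth 0%N) big_mkord; apply: leq_sum => -[i /= si] _.
elim: i si => // i IH si; apply: (leq_ltn_trans (IH (ltnW si))).
by apply: (sorted_ltn_nth ltn_trans) => //; rewrite inE// ltnW.
Qed.

Lemma sum_inj_le (m : nat) (f : 'I_m -> nat) : injective f ->
  (\sum_(i < m) i <= \sum_(i < m) f i)%N.
Proof.
move=> fI; have := @sum_iota_le [seq f i | i <- enum 'I_m].
rewrite map_inj_uniq// enum_uniq size_map size_enum_ord big_map big_enum; exact.
Qed.

Lemma widen_leq (n : nat) (j : 'I_n) : (j < n.+1)%N.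
Proof. exact: leqW. Qed.

Definition inc (n : nat) (j : 'I_n) : 'I_j.+1 -> 'I_n.+1 := widen_ord (widen_leq j).

Lemma inc_inj (n : nat) (j : 'I_n) : injective (inc (j := j)).
Proof. by move=> a b /(congr1 val) /= /val_inj. Qed.

Lemma sum_inc (n : nat) (j : 'I_n) (F : 'I_n.+1 -> nat) :
  (\sum_(i < n.+1 | i <= j) F i = \sum_(a < j.+1) F (inc a))%N.
Proof. exact: (big_ord_narrow (widen_leq j)). Qed.

Lemma mult_add (n : nat) (sigma : 'S_n.+1) (j : 'I_n) :
  (\sum_(a < j.+1) a + mult sigma j = \sum_(a < j.+1) sigma (inc a))%N.
Proof.
rewrite /mult !sum_inc subnKC//; apply: (@sum_inj_le _ (fun a => sigma (inc a))).
by move=> a b /val_inj /perm_inj /inc_inj.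
Qed.

(** Minimality of 0 + ... + j, applied to the distinct numbers n - sigma i, bounds the sum of the
    sigma i from above; this gives (j + 1)(n - j), which is at most (n + 1)^2 / 4 by the inequality
    of arithmetic and geometric means. *)
Lemma mult_le (n : nat) (sigma : 'S_n.+1) (j : 'I_n) : (mult sigma j <= r_bullet n)%N.
Proof.
have h1 : (\sum_(a < j.+1) a <= \sum_(a < j.+1) (n - sigma (inc a)))%N.
  apply: sum_inj_le => a b ab; apply: (@inc_inj _ j); apply: (@perm_inj _ sigma).
  have ha := ltn_ord (sigma (inc a)); have hb := ltn_ord (sigma (inc b)).
  apply: val_inj; rewrite /= -(subKn (ltnSE ha)) ab subKn//.
have h2 : (\sum_(a < j.+1) (n - sigma (inc a)) + \sum_(a < j.+1) sigma (inc a) = j.+1 * n)%N.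
  rewrite -big_split /= (eq_bigr (fun _ => n)) => [|a _].
    by rewrite sum_nat_const card_ord.
  by rewrite subnK// -ltnS.
have h3 : ((\sum_(a < j.+1) a).*2 = j.+1 * j)%N.
  have -> : (\sum_(a < j.+1) a = \sum_(0 <= a < j.+1) a)%N by rewrite big_mkord.
  by rewrite bin2_sum bin2 -divn2 -muln2 /= divnK// dvdn2 oddM /= andNb.
have h4 : (mult sigma j <= j.+1 * (n - j))%N.
  rewrite mulnBr leq_subRL; last by rewrite leq_mul2l /= ltnW.
  by rewrite -h3 -h2 -mult_add -addnn -addnA leq_add2r.
apply: (leq_trans h4); rewrite /r_bullet leq_divRL//.
have : (4 * (j.+1 * (n - j)) <= (j.+1 + (n - j)) ^ 2)%N by exact: nat_AGM2.
by rewrite addSn subnKC ?(ltnW (ltn_ord j))// (mulnC 4).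
Qed.

(** * Southwest minors *)

(** The falling factorial of m of length c is a monic polynomial of degree c in m. So the matrix is
    a transposed Vandermonde matrix times a unitriangular matrix of coefficients. *)
Lemma det_ffact (R : realType) (p : nat) (k : 'I_p -> nat) : injective k ->
  \det (\matrix_(a < p, c < p) ((k a) ^_ c)%:R : 'M[R]_p) != 0.
Proof.
move=> kI.
pose q (c : nat) : {poly R} := \prod_(i < c) ('X - (i%:R)%:P).
have qm c : q c \is monic by apply: monic_prod => i _; exact: monicXsubC.
have qs c : size (q c) = c.+1.
  by rewrite size_prod_XsubC /index_enum -enumT size_enum_ord.
have qE c m : (m ^_ c)%:R = (q c).[m%:R].
  rewrite /q horner_prod; elim: c => [|c IH]; first by rewrite big_ord0.
  rewrite big_ord_recr /= -IH hornerXsubC ffactnSr natrM.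
  have [cm|mc] := leqP c m; first by rewrite natrB.
  by rewrite ffact_small// !mul0r.
pose V : 'M[R]_p := Vandermonde p (\row_a (k a)%:R).
pose S : 'M[R]_p := \matrix_(l < p, c < p) (q c)`_l.
have -> : \matrix_(a < p, c < p) ((k a) ^_ c)%:R = V^T *m S.
  apply/matrixP => a c; rewrite !mxE qE (@horner_coef_wide _ p); last by rewrite qs.
  by apply: eq_bigr => l _; rewrite !mxE mulrC.
rewrite det_mulmx det_tr mulf_neq0//.
  rewrite det_Vandermonde; apply/prodf_neq0 => i _; apply/prodf_neq0 => l il.
  rewrite !mxE subr_eq0 eqr_nat; apply: contraTneq il => /kI ->; by rewrite ltnn.
rewrite -det_tr det_trig; last first.
  by apply/is_trig_mxP => c l cl; rewrite !mxE nth_default// qs.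
apply/prodf_neq0 => i _; rewrite !mxE.
by have := monicP (qm i); rewrite /lead_coef qs /= => ->; exact: oner_neq0.
Qed.

Lemma det_scale (R : comNzRingType) (p : nat) (u v : 'I_p -> R) (M : 'M[R]_p) :
  \det (\matrix_(a, c) (u a * M a c * v c)) =
  (\prod_a u a) * \det M * \prod_c v c.
Proof.
have -> : \matrix_(a, c) (u a * M a c * v c) =
    diag_mx (\row_a u a) *m M *m diag_mx (\row_c v c).
  apply/matrixP => a c; rewrite mul_mx_diag mul_diag_mx !mxE //.
rewrite !det_mulmx !det_diag; congr (_ * _ * _); by apply: eq_bigr => a _; rewrite mxE.
Qed.

Lemma upper_triangularP (R : realType) (m : nat) (U : 'M[R]_m) :
  upper_triangular U -> forall i j : 'I_m, (j < i)%N -> U i j = 0.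
Proof. by move=> /is_trig_mxP H i j ji; have := H j i ji; rewrite mxE. Qed.

Lemma upper_triangular_diag (R : realType) (m : nat) (U : 'M[R]_m) :
  upper_triangular U -> U \in unitmx -> forall i, U i i != 0.
Proof.
move=> tU; rewrite unitmxE unitfE -det_tr (det_trig tU) => /prodf_neq0 H i.
by have := H i isT; rewrite mxE.
Qed.

(** The rows are taken from the bottom upwards, which changes a southwest minor at most by a sign
    and makes the factor [eta n] of [eta n * sigma] cancel in [minor_perm]. *)
Definition minor (R : realType) (n : nat) (j : 'I_n) (Q : 'M[R]_n.+1) : R :=
  \det (\matrix_(a < j.+1, c < j.+1) Q (rev_ord (inc a)) (inc c)).

(** Left multiplication by U replaces a row by a combination of itself and lower rows, so the bottom
    j + 1 rows are mixed only among themselves, by the southeast block B of U. With rows and columns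
    reversed B is lower triangular, and its diagonal is nonzero. *)
Lemma minor_mul_upper (R : realType) (n : nat) (j : 'I_n) (U : 'M[R]_n.+1) :
  upper_triangular U -> U \in unitmx ->
  exists2 l, l != 0 & forall X, minor j (U *m X) = l * minor j X.
Proof.
move=> tU uU.
pose B : 'M[R]_j.+1 := \matrix_(a, b) U (rev_ord (inc a)) (rev_ord (inc b)).
exists (\det B).
  rewrite det_trig.
    by apply/prodf_neq0 => a _; rewrite mxE; exact: upper_triangular_diag.
  apply/is_trig_mxP => a b ab; rewrite mxE (upper_triangularP tU)//=.
  by rewrite ltn_sub2l// !ltnS (leq_trans (ltn_ord _))// ltnS ltnW.
move=> X; rewrite /minor -det_mulmx; congr (\det _).
apply/matrixP => a c; rewrite !mxE (reindex_inj rev_ord_inj) /=.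
under [RHS]eq_bigr do rewrite !mxE.
rewrite (bigID (fun l : 'I_n.+1 => (l < j.+1)%N)) /= [X in _ + X]big1 ?addr0.
  by rewrite (big_ord_narrow (widen_leq j)).
move=> l; rewrite -leqNgt => jl; rewrite (upper_triangularP tU) ?mul0r//=.
rewrite ltn_sub2l// ?ltnS; first by rewrite (leq_trans (ltn_ord _))// ltnS ltnW.
by rewrite (leq_trans (ltn_ord a)).
Qed.

Lemma minor_perm (R : realType) (n : nat) (j : 'I_n) (sigma : 'S_n.+1) (X : 'M[R]_n.+1) :
  minor j (perm_mx (eta n * sigma) *m X) =
  \det (\matrix_(a < j.+1, c < j.+1) X (sigma (inc a)) (inc c)).
Proof.
congr (\det _); apply/matrixP => a c; rewrite [LHS]mxE [RHS]mxE -row_permE mxE.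
by rewrite permM /eta permE rev_ordK.
Qed.

(** * The minors along a locally convex curve *)

Lemma asymp_det (R : realType) (t0 : R) (p : nat) (M : R -> 'M[R]_p) (h : 'I_p -> nat)
    (Y : 'M[R]_p) :
  (forall a c, asymp (fun t => M t a c) t0 (h a) (Y a c)) ->
  asymp (fun t => \det (M t)) t0 (\sum_a h a) (\det Y).
Proof.
move=> MY; apply: asymp_sum => s _; apply: asympZ; apply: asymp_prod => a; exact: MY.
Qed.

Definition generator (R : realType) (n : nat) (K : 'I_n -> R) : 'M[R]_n.+1 :=
  \sum_(j < n) K j *: frak_a R j.

Lemma mul_generatorE (R : realType) (n : nat) (K : 'I_n -> R) (X : 'M[R]_n.+1) l c :
  (X *m generator K) l c = \sum_(j < n) K j *
    (X l (lift ord0 j) * (c == widen_ord (leqnSn n) j)%:R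
     - X l (widen_ord (leqnSn n) j) * (c == lift ord0 j)%:R).
Proof.
rewrite /generator mulmx_sumr summxE; apply: eq_bigr => j _.
rewrite -scalemxAr mxE; congr (_ * _); rewrite mulmxBr mxE [X in _ + X]mxE.
have mulD (i k : 'I_n.+1) : (X *m delta_mx i k) l c = X l i * (c == k)%:R.
  rewrite mxE (bigD1 i)//= big1 => [|i' i'i]; last by rewrite mxE (negbTE i'i) mulr0.
  by rewrite mxE eqxx addr0.
by rewrite !mulD.
Qed.

(** * Leading terms of a frame that is upper triangular at t0 *)

Section frame.
Variables (R : realType) (n : nat) (X : R -> 'M[R]_n.+1) (K : 'I_n -> R -> R) (t0 : R).
Hypothesis t01 : 0 <= t0 <= 1.
Hypothesis dX : forall t : R, 0 <= t <= 1 -> forall l c,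
  is_derive t 1 (fun s => X s l c) ((X t *m generator (K^~ t)) l c).
Hypothesis cK : forall j, asymp (K j) t0 0 (K j t0).
Hypothesis K0 : forall j, K j t0 != 0.
Hypothesis tX : upper_triangular (X t0).

(** For c <= l, [weight l / weight c] is the product of the kappa_j(t0) with c <= j < l: the factors
    collected when X_lc is found from X_ll by l - c integrations. *)
Definition weight (c : nat) : R := \prod_(j < n | (j < c)%N) K j t0.

Lemma weight_neq0 c : weight c != 0.
Proof. by apply/prodf_neq0 => j _. Qed.

Lemma weightS (j : 'I_n) : weight j.+1 = K j t0 * weight j.
Proof.
rewrite /weight (bigD1 j)//=; congr (_ * _); apply: eq_bigl => i.
by rewrite ltnS [RHS]ltn_neqAle andbC.
Qed.

(* Below the diagonal, lead l c is the coefficient of (t - t0)^(l - c) in X_lc(t). *)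
Definition lead (l c : 'I_n.+1) : R :=
  if (c < l)%N then X t0 l l * weight l / (weight c * (l - c)`!%:R) else X t0 l c.

Lemma lead_diag l : lead l l = X t0 l l * weight l / (weight l * (l - l)`!%:R).
Proof. by rewrite /lead ltnn subnn mulr1 mulfK// weight_neq0. Qed.

Lemma leadE (l c : 'I_n.+1) : (c <= l)%N ->
  lead l c = X t0 l l * weight l / (weight c * (l - c)`!%:R).
Proof.
rewrite leq_eqVlt => /orP[/eqP/val_inj ->|cl]; first exact: lead_diag.
by rewrite /lead cl.
Qed.

Lemma lead_rec (l : 'I_n.+1) (j : 'I_n) : (j < l)%N ->
  lead l (widen_ord (leqnSn n) j) = K j t0 * lead l (lift ord0 j) / (l - j)%:R.
Proof.
move=> jl; rewrite !leadE//=; last exact: ltnW.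
have -> : bump 0 j = j.+1 by [].
have -> : (l - j = (l - j.+1).+1)%N by rewrite -subSn.
rewrite weightS factS natrM; field.
by rewrite K0 weight_neq0 addrC natr1 !pnatr_eq0 -!lt0n fact_gt0.
Qed.

(** X_lc' = kappa_c X_l(c+1) - kappa_(c-1) X_l(c-1) involves both neighbouring columns, so the
    induction runs on the precision m and treats all columns at once. For m < l - c, the column c -
    1 has an order larger than m and adds 0 to the coefficient at order m; the column c + 1 gives
    the leading term, which is then integrated once. *)
Lemma frame_step (m : nat) (l c : 'I_n.+1) :
  asymp (fun t => X t l c) t0 (minn m (l - c)) (if (l - c <= m)%N then lead l c else 0).
Proof.
elim: m c => [|m IH] c.
  rewrite min0n leqn0 subn_eq0.
  have -> : (if (l <= c)%N then lead l c else 0) = X t0 l c.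
    by rewrite /lead; case: ltnP => // cl; rewrite upper_triangularP.
  by apply: asymp_continuous; exact: is_derive_continuous (dX t01 l c).
have [lcm|mlc] := leqP (l - c) m.
  rewrite (leqW lcm); have := IH c; rewrite lcm.
  by rewrite !(minn_idPr _)// leqW.
have cl : (c < l)%N by rewrite -subn_gt0 (leq_trans _ mlc).
have cn : (c < n)%N by rewrite (leq_trans cl)// -ltnS.
pose c' := Ordinal cn.
have cE : c = widen_ord (leqnSn n) c' by apply: val_inj.
have X0 : X t0 l c = 0 by rewrite upper_triangularP.
rewrite (minn_idPl mlc).
pose a := K c' t0 * (if (l - c <= m.+1)%N then lead l (lift ord0 c') else 0).
have -> : (if (l - c <= m.+1)%N then lead l c else 0) = a / m.+1%:R.
  rewrite /a; case: ifP => lcm; last by rewrite mulr0 mul0r.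
  have e : (l - c' = m.+1)%N by apply/eqP; rewrite eqn_leq lcm.
  by rewrite cE lead_rec//= e.
apply: (asymp_primitive t01 (fun t h => dX h l c) X0).
have term j : asymp (fun t => K j t * (X t l (lift ord0 j) * (c == widen_ord (leqnSn n) j)%:R
     - X t l (widen_ord (leqnSn n) j) * (c == lift ord0 j)%:R)) t0 m
     (if j == c' then a else 0).
  have [cj|/negPf cj] := eqVneq c (widen_ord (leqnSn n) j).
    have jc : j = c' by apply: val_inj; rewrite /= cj.
    have cj' : (c == lift ord0 j) = false.
      by apply/negbTE; rewrite cj -val_eqE /= /bump /= neq_ltn ltnSn.
    rewrite jc eqxx; apply: (@asymp_ext _ _ (fun t => K c' t * X t l (lift ord0 c'))).
      by move=> t _; rewrite -jc cj' mulr1n mulr0n mulr1 mulr0 subr0.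
    rewrite -[m]add0n; apply: asympM; first exact: cK.
    have := IH (lift ord0 c'); rewrite /= /bump /= add1n.
    rewrite (minn_idPl _); last by rewrite -ltnS -subSn.
    by rewrite -[(l - c' <= m.+1)%N]/(l - c' <= m.+1)%N -ltnS -subSn.
  have [jc|/negPf jc] := eqVneq j c'.
    by move: cj; rewrite jc -cE eqxx.
  have [cj'|/negPf cj'] := eqVneq c (lift ord0 j).
    rewrite -[m]add0n -(mulr0 (K j t0)); apply: asympM; first exact: cK.
    apply: (@asymp_ext _ _ (fun t => -1 * X t l (widen_ord (leqnSn n) j))).
      by move=> t _; rewrite mulr0 mulr1 sub0r mulN1r.
    rewrite -(mulr0 (-1)); apply: asympZ.
    have := IH (widen_ord (leqnSn n) j).
    have jm : (m < l - widen_ord (leqnSn n) j)%N.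
      by apply: (leq_trans mlc); rewrite leq_sub2l// cj' /= /bump /= leqnSn.
    by rewrite leqNgt jm /= (minn_idPl (ltnW jm)).
  apply: (@asymp_ext _ _ (fun t => 0 * (t - t0) ^+ m)).
    by move=> t _; rewrite !mulr0 subrr mulr0 mul0r.
  by have := asympZ 0 (asymp_pow t0 m); rewrite mul0r.
apply: (@asymp_ext _ _ (fun t => \sum_(j < n) K j t *
    (X t l (lift ord0 j) * (c == widen_ord (leqnSn n) j)%:R
     - X t l (widen_ord (leqnSn n) j) * (c == lift ord0 j)%:R))).
  by move=> t _; rewrite mul_generatorE.
have -> : a = \sum_(j < n) (if j == c' then a else 0).
  by rewrite -big_mkcond big_pred1_eq.
exact: asymp_sum.
Qed.

(** The factor (t - t0)^c gives all entries of row l the common order l, so that the leading term of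
    a determinant is the determinant of the leading coefficients. Above the diagonal the order is
    larger than l, hence the coefficient 0. *)
Lemma frame_asymp (l c : 'I_n.+1) :
  asymp (fun t => (t - t0) ^+ c * X t l c) t0 l
    (if (c <= l)%N then X t0 l l * weight l / (weight c * (l - c)`!%:R) else 0).
Proof.
have := frame_step n l c.
have ln : (l - c <= n)%N by rewrite (leq_trans (leq_subr _ _))// -ltnS.
rewrite ln (minn_idPr ln) => H.
have := asympM (asymp_pow t0 c) H; rewrite mul1r.
case: leqP => [cl|lc]; first by rewrite subnKC// leadE.
by apply: asymp_lt; rewrite (leq_trans lc)// leq_addr.
Qed.

(** Since 1 / (l - c)! is the falling factorial of l of length c divided by l!, the leading
    coefficients form the matrix of [det_ffact] with rows and columns rescaled by nonzero
    numbers. *)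
Lemma frame_minor (sigma : 'S_n.+1) (j : 'I_n) : (forall i, X t0 i i != 0) ->
  exists2 l, l != 0 & asymp (fun t =>
     \det (\matrix_(a < j.+1, c < j.+1) X t (sigma (inc a)) (inc c))) t0 (mult sigma j) l.
Proof.
move=> Xd.
pose k (a : 'I_j.+1) : 'I_n.+1 := sigma (inc a).
have kI : injective (fun a => k a : nat).
  by move=> a b /val_inj /perm_inj /inc_inj.
pose Y : 'M[R]_j.+1 := \matrix_(a, c)
  ((X t0 (k a) (k a) * weight (k a) / (k a)`!%:R) *
   (\matrix_(a < j.+1, c < j.+1) ((k a) ^_ c)%:R : 'M[R]_j.+1) a c * (weight c)^-1).
exists (\det Y).
  rewrite det_scale; apply: mulf_neq0; first apply: mulf_neq0.
  - apply/prodf_neq0 => a _; apply: mulf_neq0; first by rewrite mulf_neq0 ?weight_neq0.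
    by rewrite invr_eq0 pnatr_eq0 -lt0n fact_gt0.
  - exact: det_ffact.
  - by apply/prodf_neq0 => c _; rewrite invr_eq0 weight_neq0.
have key : asymp (fun t => \det (\matrix_(a < j.+1, c < j.+1)
     ((t - t0) ^+ c * X t (k a) (inc c)))) t0 (\sum_a k a) (\det Y).
  apply: asymp_det => a c; rewrite !mxE.
  apply: (@asymp_ext _ _ (fun t => (t - t0) ^+ (inc c) * X t (k a) (inc c))).
    by move=> t _; rewrite mxE.
  have := frame_asymp (k a) (inc c).
  congr (asymp _ _ _ _) => /=.
  have [ck|kc] := leqP c (k a); last by rewrite ffact_small// mulr0 mul0r.
  rewrite -(ffact_fact ck) natrM.
  field; rewrite weight_neq0 !pnatr_eq0 -!lt0n fact_gt0 ffact_gt0 ck //.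
(* The determinant with the column factors has order sigma 0 + ... + sigma j; the factors account
   for 0 + ... + j of it, and [mult sigma j] remains. *)
rewrite -mult_add in key; apply: asymp_cancel_pow; apply: asymp_ext key => t _.
rewrite [LHS](_ : _ = \det (\matrix_(a, c) (1 * (\matrix_(a < j.+1, c < j.+1)
   X t (k a) (inc c)) a c * (t - t0) ^+ c))); last first.
  by congr (\det _); apply/matrixP => a c; rewrite !mxE mul1r mulrC.
by rewrite det_scale big1// mul1r mulrC prodrXr.
Qed.

End frame.

(** * The double cover in coordinates *)

Lemma cl_sign0l (R : realType) (m : nat) (B : {set 'I_m}) : cl_sign R finset.set0 B = 1.
Proof.
by rewrite /cl_sign (eq_card0 (A := [pred p | _])) ?expr0// => p; rewrite !inE.
Qed.

Lemma cl_sign0r (R : realType) (m : nat) (A : {set 'I_m}) : cl_sign R A finset.set0 = 1.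
Proof.
by rewrite /cl_sign (eq_card0 (A := [pred p | _])) ?expr0// => p; rewrite !inE andbF.
Qed.

Lemma cl_mul1x (R : realType) (m : nat) (x : clifford R m) : cl_mul (cl_one R m) x = x.
Proof.
apply/ffunP => C; rewrite !ffunE (bigD1 finset.set0)//= [X in _ + X]big1 ?addr0.
  rewrite (bigD1 C)/=; last by rewrite finset.set0D finset.setD0 finset.set0U eqxx.
  rewrite big1 ?addr0 => [|B /andP[/eqP <-]].
    by rewrite cl_sign0l ffunE eqxx !mul1r.
  by rewrite finset.set0D finset.setD0 finset.set0U eqxx.
by move=> A /negPf A0; rewrite big1// => B _; rewrite ffunE A0 mulr0 mul0r.
Qed.

Lemma cl_mulx1 (R : realType) (m : nat) (x : clifford R m) : cl_mul x (cl_one R m) = x.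
Proof.
apply/ffunP => C; rewrite !ffunE (bigD1 C)//= [X in _ + X]big1 ?addr0.
  rewrite (bigD1 finset.set0)/=; last by rewrite finset.set0D finset.setD0 finset.setU0 eqxx.
  rewrite big1 ?addr0 => [|B /andP[_ /negPf B0]]; last by rewrite ffunE B0 mulr0.
  by rewrite cl_sign0r ffunE eqxx mul1r mulr1.
move=> A AC; rewrite big1// => B /eqP BC; rewrite ffunE.
case: eqP => [B0|]; last by rewrite mulr0.
by move: AC; rewrite -BC B0 finset.set0D finset.setD0 finset.setU0 eqxx.
Qed.

Lemma Pi_one (R : realType) (m : nat) : Pi (cl_one R m) = 1%:M.
Proof.
apply/matrixP => i j; rewrite mxE cl_mul1x.
have -> : cl_conj (cl_one R m) = cl_one R m.
  apply/ffunP => A; rewrite !ffunE; case: eqP => [->|_]; last by rewrite mulr0.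
  by rewrite cards0 expr0 mul1r.
rewrite cl_mulx1 ffunE mxE (bigD1 i)//= big1 ?addr0.
  by rewrite mxE eqxx.
by move=> k /andP[/eqP/finset.set1_inj -> ]; rewrite eqxx.
Qed.

Lemma Ck_cvg_mul (R : realType) (k m : nat) (X Y : option nat -> R -> clifford R m) :
  (forall A, Ck_cvg k (fun o x => X o x A)) -> (forall A, Ck_cvg k (fun o x => Y o x A)) ->
  forall C, Ck_cvg k (fun o x => cl_mul (X o x) (Y o x) C).
Proof.
move=> XK YK C; apply: (@Ck_cvg_ext _ _ (fun o x => \sum_(A : {set 'I_m})
  \sum_(B : {set 'I_m} | (A :\: B) :|: (B :\: A) == C) cl_sign R A B * X o x A * Y o x B)).
  by move=> o x; rewrite ffunE.
apply: Ck_cvg_sum => A _; apply: Ck_cvg_sum => B _; apply: Ck_cvgM => //.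
by apply: Ck_cvgM => //; exact: Ck_cvg_cst.
Qed.

Lemma Ck_cvg_Pi (R : realType) (k m : nat) (X : option nat -> R -> clifford R m) :
  (forall A, Ck_cvg k (fun o x => X o x A)) ->
  forall i j, Ck_cvg k (fun o x => Pi (X o x) i j).
Proof.
move=> XK i j; apply: (@Ck_cvg_ext _ _ (fun o x =>
  cl_mul (cl_mul (X o x) (cl_vec (delta_mx ord0 j))) (cl_conj (X o x)) [set i]%SET)).
  by move=> o x; rewrite mxE.
apply: Ck_cvg_mul.
  by apply: Ck_cvg_mul => // A; exact: Ck_cvg_cst.
move=> A; apply: (@Ck_cvg_ext _ _ (fun o x => (-1) ^+ 'C(#|A|.+1, 2) * X o x A)).
  by move=> o x; rewrite ffunE.
by apply: Ck_cvgM => //; exact: Ck_cvg_cst.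
Qed.

(** * The differential equation along a curve *)

Lemma deriv01_asymp (R : realType) (f : R -> R) (t d : R) :
  deriv01 f t d -> asymp (fun s => f s - f t) t 1 d.
Proof.
move=> /cvgrPdist_lt H e e0; have /nbhs_ballP[r /= r0 Hr] := H e e0.
exists r => // s s01 /andP[st sr].
have st0 : s != t by rewrite -subr_eq0 -normr_gt0.
have : `|d - (f s - f t) / (s - t)| < e.
  apply: Hr => //=.
  by rewrite /ball /= distrC.
rewrite !expr1 => h.
have -> : f s - f t - d * (s - t) = ((f s - f t) / (s - t) - d) * (s - t).
  by field; rewrite subr_eq0.
by rewrite normrM ler_wpM2r// distrC ltW.
Qed.

(** Both derivatives are leading coefficients of order 1 of the same increment on [0, 1], and such
    coefficients are unique, even at the ends. *)
Lemma derive01_unique (R : realType) (f f' g : R -> R) (t d : R) :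
  0 <= t <= 1 -> (forall s, 0 <= s <= 1 -> f s = g s) ->
  (forall x : R, 0 <= x <= 1 -> is_derive x 1 f (f' x)) -> {for t, continuous f'} ->
  deriv01 g t d -> f' t = d.
Proof.
move=> t01 fg df cf' /deriv01_asymp dg.
apply: (asymp_unique t01 _ dg).
apply: (@asymp_ext _ _ (fun s => f s - f t)).
  by move=> s s01; rewrite !fg.
rewrite -[f' t]divr1; apply: (asymp_primitive t01 _ _ (asymp_continuous cf')).
  move=> x x01; have := is_deriveB (df x x01) (is_derive_cst (f t) x 1).
  by rewrite subr0.
by rewrite subrr.
Qed.

Lemma derive0_const01 (R : realType) (f : R -> R) :
  (forall x : R, 0 <= x <= 1 -> is_derive x 1 f 0) ->
  forall x, 0 <= x <= 1 -> f x = f 0.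
Proof.
move=> df x x01; move: (x01) => /andP[]; rewrite le_eqVlt => /orP[/eqP <-//|x0 _].
have [|z _] := @MVT01 R f (fun _ => 0) 0 x df _ x01 x0; first by rewrite lexx ler01.
by rewrite mul0r => /eqP; rewrite subr_eq0 => /eqP.
Qed.

Lemma generator_skew (R : realType) (n : nat) (K : 'I_n -> R) :
  (generator K)^T = - generator K.
Proof.
rewrite /generator linear_sum -sumrN; apply: eq_bigr => j _ /=.
by rewrite linearZ /= -scalerN /frak_a linearB /= !trmx_delta opprB.
Qed.

Lemma generator_entry (R : realType) (n : nat) (K : 'I_n -> R) (j : 'I_n) :
  generator K (lift ord0 j) (widen_ord (leqnSn n) j) = K j.
Proof.
rewrite -[generator K]mul1mx mul_generatorE (bigD1 j)//= big1 ?addr0 => [|i ij].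
  rewrite !mxE !eqxx.
  rewrite (_ : (widen_ord _ j == lift ord0 j) = false) ?mulr0 ?subr0 ?mulr1//.
  by apply/negbTE; rewrite -val_eqE /= /bump /= neq_ltn ltnSn.
rewrite !mxE.
have -> : (widen_ord (leqnSn n) j == widen_ord (leqnSn n) i) = false.
  by apply/negbTE; apply: contraNneq ij => /(congr1 val) /= /val_inj ->.
rewrite mulr0 sub0r -natrM mulnb.
have -> : (lift ord0 j == widen_ord (leqnSn n) i) && (widen_ord (leqnSn n) j == lift ord0 i) = false.
  apply/negbTE/negP => /andP[/eqP/(congr1 val)/= + /eqP/(congr1 val)/=].
  rewrite /bump /= !add1n => e1 e2.
  by have := ltnn j; rewrite {2}e2 -e1 ltnS leqnSn.
by rewrite oppr0 mulr0.
Qed.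

Section curve.
Variables (R : realType) (n : nat) (Q dQ : R -> 'M[R]_n.+1) (kap : R -> 'I_n -> R).
Hypothesis dQE : forall t : R, 0 <= t <= 1 -> forall i k,
  is_derive t 1 (fun s => Q s i k) (dQ t i k).
Hypothesis cdQ : forall t : R, 0 <= t <= 1 -> forall i k,
  {for t, continuous (fun s => dQ s i k)}.
Hypothesis odeQ : forall t : R, 0 <= t <= 1 -> dQ t = Q t *m generator (kap t).
Hypothesis kap0 : forall t : R, 0 <= t <= 1 -> forall j, 0 < kap t j.
Hypothesis Q0 : Q 0 = 1%:M.

(** The generator is skew-symmetric, so Q Q^T has derivative 0, and it is the identity at time 0. No
    computation in the Clifford algebra is involved. *)
Lemma frame_orthogonal (t : R) : 0 <= t <= 1 -> Q t *m (Q t)^T = 1%:M.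
Proof.
move=> t01; apply/matrixP => i k.
pose f s := (Q s *m (Q s)^T) i k.
have fE : f = fun s => \sum_(l < n.+1) Q s i l * Q s k l.
  by apply/funext => s; rewrite /f mxE; apply: eq_bigr => l _; rewrite mxE.
have df (x : R) : 0 <= x <= 1 -> is_derive x 1 f 0.
  move=> x01.
  have -> : (0 : R) = \sum_(l < n.+1) (Q x i l *: dQ x k l + Q x k l *: dQ x i l).
    have : (Q x *m (dQ x)^T + dQ x *m (Q x)^T) i k = 0.
      by rewrite odeQ// trmx_mul generator_skew mulNmx mulmxN mulmxA addNr mxE.
    rewrite mxE mxE [X in _ + X]mxE -big_split /= => {1}<-.
    by apply: eq_bigr => l _; rewrite !mxE /GRing.scale /= [X in _ + X]mulrC.
  rewrite fE; rewrite (_ : (fun s => _) = \sum_(l < n.+1) (fun s => Q s i l * Q s k l)).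
    by apply: is_derive_sum => l; apply: is_deriveM; exact: dQE.
  by apply/funext => s; rewrite fct_sumE.
have := derive0_const01 df t01; rewrite {2}/f Q0 trmx1 mulmx1; exact.
Qed.

Lemma frame_unit (t : R) : 0 <= t <= 1 -> Q t \in unitmx.
Proof. by move=> t01; have := frame_orthogonal t01 => /mulmx1_unit[]. Qed.

(** The numbers [kap t j] are given pointwise, with no regularity in t. Reading them off from Q^T Q'
    shows that they depend continuously on t. *)
Lemma kapE (t : R) (j : 'I_n) : 0 <= t <= 1 ->
  kap t j = \sum_(i < n.+1) Q t i (lift ord0 j) * dQ t i (widen_ord (leqnSn n) j).
Proof.
move=> t01; rewrite -(generator_entry (kap t) j).
have -> : generator (kap t) = (Q t)^T *m dQ t.
  by rewrite odeQ// mulmxA (mulmx1C (frame_orthogonal t01)) mul1mx.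
by rewrite mxE; apply: eq_bigr => i _; rewrite mxE.
Qed.

Lemma minor_asymp (t0 : R) (U0 U1 : 'M[R]_n.+1) (sigma : 'S_n.+1) (j : 'I_n) :
  0 <= t0 <= 1 ->
  upper_triangular U0 -> U0 \in unitmx -> upper_triangular U1 -> U1 \in unitmx ->
  Q t0 = U0 *m perm_mx (eta n * sigma) *m U1 ->
  exists2 l, l != 0 & asymp (fun t => minor j (Q t)) t0 (mult sigma j) l.
Proof.
move=> t01 tU0 uU0 tU1 uU1 Qt0.
pose s := (eta n * sigma)%g.
pose A : 'M[R]_n.+1 := perm_mx s^-1 *m invmx U0.
pose X t := A *m Q t.
have sK : perm_mx s *m perm_mx s^-1 = 1%:M :> 'M[R]_n.+1.
  by rewrite -perm_mxM mulgV perm_mx1.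
have QX t : Q t = U0 *m (perm_mx s *m X t).
  by rewrite /X /A -mulmxA (mulmxA (perm_mx s)) sK mul1mx mulKVmx.
have X0 : X t0 = U1.
  have sK' : perm_mx s^-1 *m perm_mx s = 1%:M :> 'M[R]_n.+1.
    by rewrite -perm_mxM mulVg perm_mx1.
  by rewrite /X /A Qt0 -!mulmxA mulKmx// mulmxA sK' mul1mx.
have dX (t : R) : 0 <= t <= 1 -> forall l c,
    is_derive t 1 (fun s => X s l c) ((X t *m generator (kap t)) l c).
  move=> tt l c; rewrite /X -mulmxA -odeQ// mxE.
  have XE : (fun s => (A *m Q s) l c) = \sum_(i < n.+1) (fun s => A l i *: Q s i c).
    by apply/funext => x; rewrite fct_sumE mxE.
  by rewrite XE; apply: is_derive_sum => i; apply: is_deriveZ; exact: dQE.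
have cK i : asymp (fun t => kap t i) t0 0 (kap t0 i).
  rewrite kapE//; apply: (@asymp_ext _ _ (fun t =>
    \sum_(k < n.+1) Q t k (lift ord0 i) * dQ t k (widen_ord (leqnSn n) i))).
    by move=> t tt; rewrite kapE.
  apply: asymp_sum => k _; rewrite -[0%N]addn0; apply: asympM; apply: asymp_continuous.
    exact: is_derive_continuous (dQE t01 _ _).
  exact: cdQ.
have K0 i : kap t0 i != 0 by rewrite gt_eqF// kap0.
have tX : upper_triangular (X t0) by rewrite X0.
have [|l l0 al] := frame_minor t01 dX cK K0 tX sigma j.
  by rewrite X0; exact: upper_triangular_diag.
have [m m0 Hm] := minor_mul_upper j tU0 uU0.
exists (m * l); first by rewrite mulf_neq0.
apply: (asymp_ext _ (asympZ m al)) => t _.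
by rewrite [in RHS]QX Hm minor_perm.
Qed.

End curve.

(** * Itineraries *)

Lemma eta_mul_eta (n : nat) : (eta n * eta n)%g = 1%g.
Proof. by apply/permP => i; rewrite permM /eta !permE rev_ordK. Qed.

Lemma upper_triangular1 (R : realType) (m : nat) : upper_triangular (1%:M : 'M[R]_m).
Proof. by rewrite /upper_triangular trmx1 scalar_mx_is_trig. Qed.

Lemma mult1 (n : nat) (j : 'I_n) : mult 1 j = 0%N.
Proof.
rewrite /mult; under eq_bigr do rewrite perm1.
by rewrite subnn.
Qed.

Section curve_minor.
Variables (R : realType) (n r : nat) (Gamma X : R -> clifford R n.+1) (dQ : R -> 'M[R]_n.+1).
Hypothesis GL : @calL R n r Gamma.
Hypothesis XG : forall t, 0 <= t <= 1 -> X t = Gamma t.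
Hypothesis dQE : forall t : R, 0 <= t <= 1 -> forall i k,
  is_derive t 1 (fun s => Pi (X s) i k) (dQ t i k).
Hypothesis cdQ : forall t : R, 0 <= t <= 1 -> forall i k,
  {for t, continuous (fun s => dQ s i k)}.

(** [convex_at] speaks of the derivative of Pi o Gamma relative to [0, 1]; it is matched with the
    two-sided derivative dQ of the replacement X. *)
Lemma curve_ode : exists kap : R -> 'I_n -> R,
  [/\ forall t, 0 <= t <= 1 -> dQ t = Pi (X t) *m generator (kap t),
      forall t, 0 <= t <= 1 -> forall j, 0 < kap t j
    & Pi (X 0) = 1%:M].
Proof.
have [q _ [_ G0 _ _ cG]] := GL.
have /choice[kap Hkap] : forall t, exists kap : 'I_n -> R, 0 <= t <= 1 ->
    (forall j, 0 < kap j) /\ dQ t = Pi (X t) *m generator kap.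
  move=> t; have [tt|tt] := boolP (0 <= t <= 1); last by exists (fun _ => 0).
  have [|kap [k0 dk]] := cG t; first by rewrite /= in_itv.
  exists kap => _; split => //; apply/matrixP => i k.
  apply: (derive01_unique (f := fun s => Pi (X s) i k) (f' := fun s => dQ s i k) tt _ _ _ _).
  - move=> s s01; rewrite XG//.
  - by move=> x x01; exact: dQE.
  - exact: cdQ.
  - rewrite XG//; exact: dk.
exists kap; split => [t tt|t tt|].
- by have [] := Hkap t tt.
- by have [] := Hkap t tt.
- by rewrite XG ?lexx ?ler01// G0 Pi_one.
Qed.

Lemma curve_minor_Bru (t0 : R) (sigma : 'S_n.+1) (j : 'I_n) : 0 <= t0 <= 1 ->
  (exists U0 U1 : 'M[R]_n.+1,
       [/\ upper_triangular U0, U0 \in unitmx,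
           upper_triangular U1, U1 \in unitmx
         & Pi (Gamma t0) = U0 *m perm_mx (eta n * sigma) *m U1]) ->
  exists2 l, l != 0 & asymp (fun t => minor j (Pi (X t))) t0 (mult sigma j) l.
Proof.
move=> t01 [U0 [U1 [tU0 uU0 tU1 uU1]]]; rewrite -XG// => QU.
have [kap [ode kap0 X0]] := curve_ode.
exact: (minor_asymp (Q := fun t => Pi (X t)) dQE cdQ ode kap0 X0 j t01 tU0 uU0 tU1 uU1).
Qed.

(** At both ends Pi o Gamma is diagonal, hence of the form U0 P U1 with P the identity matrix, which
    belongs to [eta n * eta n]. So sigma is [eta n]. *)
Lemma curve_minor_end (t0 : R) (j : 'I_n) : t0 \in [:: 0; 1] ->
  exists2 l, l != 0 & asymp (fun t => minor j (Pi (X t))) t0 (mult (eta n) j) l.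
Proof.
have [q [_ qd] [_ G0 G1 _ cG]] := GL.
rewrite !inE => /orP[/eqP->|/eqP->].
  apply: curve_minor_Bru; first by rewrite lexx ler01.
  exists 1%:M, 1%:M; rewrite upper_triangular1 unitmx1; split => //.
  by rewrite G0 Pi_one eta_mul_eta perm_mx1 !mulmx1.
apply: curve_minor_Bru; first by rewrite lexx ler01.
exists (Pi q), 1%:M; rewrite upper_triangular1 unitmx1; split => //.
- by rewrite /upper_triangular; apply: is_diag_mx_is_trig; rewrite is_diag_trmx.
- have [kap [ode _ X0]] := curve_ode.
  rewrite -G1 -XG ?lexx ?ler01//.
  by apply: (frame_unit (Q := fun t => Pi (X t)) dQE ode X0); rewrite lexx ler01.
- by rewrite G1 eta_mul_eta perm_mx1 !mulmx1.
Qed.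

End curve_minor.

(** One statement for two uses: for the limit curve, h is the exact order at every time and bounds
    zeros from above; for an approximating curve, S with h is the list of zeros to be counted. *)
Lemma calL_iti_orders (R : realType) (n r : nat) (w : seq 'S_n.+1) (j : 'I_n)
    (Gamma X : R -> clifford R n.+1) (dQ : R -> 'M[R]_n.+1) :
  @calL_iti R n r w Gamma ->
  (forall t, 0 <= t <= 1 -> X t = Gamma t) ->
  (forall t : R, 0 <= t <= 1 -> forall i k,
    is_derive t 1 (fun s => Pi (X s) i k) (dQ t i k)) ->
  (forall t : R, 0 <= t <= 1 -> forall i k, {for t, continuous (fun s => dQ s i k)}) ->
  exists (S : seq R) (h : R -> nat),
  [/\ sorted <%R S, all (fun t => 0 <= t <= 1) S,
      forall t, 0 <= t <= 1 -> (h t <= r_bullet n)%N /\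
        exists2 l, l != 0 & asymp (fun s => minor j (Pi (X s))) t (h t) l,
      forall t, 0 <= t <= 1 -> t \notin S -> h t = 0%N
    & (\sum_(t <- S) h t = mult_word w j + (mult (eta n) j).*2)%N].
Proof.
move=> [GL [tau [stau singE sztau Hw]]] XG dQE cdQ.
have tau01 t : t \in tau -> 0 < t < 1 by move=> /singE[].
(* For t outside tau the index is the length of w, so [nth] returns the identity, whose multiplicity
   is 0. *)
pose h (t : R) := if t \in [:: 0; 1] then mult (eta n) j
                  else mult (nth 1%g w (index t tau)) j.
exists (0 :: rcons tau 1), h.
have h_out t : t \notin [:: 0; 1] -> h t = mult (nth 1%g w (index t tau)) j.
  by rewrite /h => /negPf ->.
have not_end t : 0 < t < 1 -> t \notin [:: 0; 1].
  by move=> /andP[t0 t1]; rewrite !inE negb_or (gt_eqF t0) (lt_eqF t1).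
split.
- rewrite /= rcons_path; apply/andP; split.
    rewrite path_min_sorted//; apply/allP => t /tau01 /andP[] //.
  have := mem_last 0 tau; rewrite inE => /orP[/eqP ->|/tau01/andP[]//].
  exact: ltr01.
- rewrite /= lexx ler01 all_rcons ler01 lexx /=.
  by apply/allP => t /tau01 /andP[/ltW -> /ltW ->].
- move=> t t01; split; first by rewrite /h; case: ifP => _; exact: mult_le.
  have [te|te] := boolP (t \in [:: 0; 1]).
    by rewrite /h te; exact: (curve_minor_end GL XG dQE cdQ).
  rewrite h_out//; apply: (curve_minor_Bru GL XG dQE cdQ) => //.
  have tt : 0 < t < 1.
    by move: te; rewrite !inE negb_or !lt_def [1 == t]eq_sym => /andP[-> ->].
  have [ttau|ttau] := boolP (t \in tau).
    have it : (index t tau < size w)%N by rewrite -sztau index_mem.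
    have [_ [_]] := Hw _ it.
    by rewrite nth_index.
  (* A time in ]0, 1[ outside tau is not singular, so the curve is in the open cell there: the case
     sigma = 1. *)
  rewrite nth_default; last by rewrite -sztau memNindex.
  rewrite mulg1.
  have : ~ sing Gamma t by move=> /singE; rewrite (negbTE ttau).
  have [_ _ [[Gsp _ _] _ _ _ _]] := GL.
  move=> nsing; have /Gsp Gt : `[0, 1]%classic t by rewrite /= in_itv.
  have : Bru (eta n) (Gamma t).
    by apply: contrapT => nB; apply: nsing.
  by case.
- move=> t t01 /=; rewrite inE mem_rcons inE !negb_or => /and3P[t0 t1 ttau].
  rewrite h_out ?inE ?negb_or ?t0// nth_default ?mult1// -sztau memNindex//.
- have h0 : h 0 = mult (eta n) j by rewrite /h inE eqxx.
  have h1 : h 1 = mult (eta n) j by rewrite /h !inE eqxx orbT.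
  rewrite big_cons big_rcons /= h0 h1 -addnn [RHS]addnC -addnA; congr (_ + _)%N.
  rewrite /mult_word (big_nth 1%g) (big_nth 0) sztau [LHS]addnC.
  congr (_ + _)%N; rewrite !big_mkord; apply: eq_bigr => i _.
  have it : (i < size tau)%N by rewrite sztau.
  rewrite h_out; last by apply: not_end; apply: tau01; rewrite mem_nth.
  by rewrite index_uniq// (sorted_uniq lt_trans ltxx).
Qed.

Theorem theorem4 (R : realType) (n r : nat) (hn : (2 <= n)%N) (hr2 : (2 <= r)%N)
  (w0 w1 : seq 'S_n.+1) (hw0 : is_word w0) (hw1 : is_word w1)
  (hr : (r_bullet n < r)%N)
  (hne : @calL_iti R n r w1 `&` Hr_closure r (@calL_iti R n r w0) !=set0) :
  forall j : 'I_n, (mult_word w0 j <= mult_word w1 j)%N.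
Proof.
(* From here on r is the former r minus 1: the hypothesis [rr] says that [r_bullet n] is at most r,
   the order up to which derivatives converge uniformly. *)
move=> j; case: r hr2 hr hne => // r r1 rr [Gamma [Gw1 [_ Gcl]]].
have /choice[Delta HDelta] : forall N : nat, exists Delta, calL_iti r.+1 w0 Delta /\
    forall A, sobolev_norm_lt r.+1 (fun t => Delta t A - Gamma t A) N.+1%:R^-1.
  by move=> N; have [|Delta] := Gcl N.+1%:R^-1; [rewrite invr_gt0|exists Delta].
pose G (m : option nat) := if m is Some N then Delta N else Gamma.
have /choice[F HF] : forall A, exists F : option nat -> R -> R,
    Ck_cvg r F /\ forall m x, 0 <= x <= 1 -> F m x = G m x A.
  move=> A; have [|||F] := @sobolev_Ck_cvg R r (fun m x => G m x A).
  - have cont w D : @calL_iti R n r.+1 w D -> cont01 (fun x => D x A).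
      by move=> [[q _ [[_ ac _] _ _ _ _]] _]; exact: abs_continuous01_cont.
    by case=> [N|]; [exact: cont (HDelta N).1|exact: cont Gw1].
  - by have [[q _ [_ _ _ sG _]] _] := Gw1; exact: sG.
  - by move=> N; exact: (HDelta N).2.
  - by exists F.
(* X agrees with the curves on [0, 1] and has the two-sided derivatives that they may lack at 0 and
   1. *)
pose X m x : clifford R n.+1 := [ffun A => F A m x].
have XG m x : 0 <= x <= 1 -> X m x = G m x.
  by move=> x01; apply/ffunP => A; rewrite ffunE (HF A).2.
have XK A : Ck_cvg r (fun m x => X m x A).
  by apply: Ck_cvg_ext (HF A).1 => m x; rewrite ffunE.
have PK := Ck_cvg_Pi XK.
have /choice[dP HdP] : forall ik : 'I_n.+1 * 'I_n.+1, exists d : option nat -> R -> R,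
    forall m (x : R), 0 <= x <= 1 ->
    is_derive x 1 (fun s => Pi (X m s) ik.1 ik.2) (d m x) /\ {for x, continuous (d m)}.
  (* The condition r >= 2 of the statement is now 0 < r, which provides one continuous
     derivative. *)
  move=> [i k]; have [_ _ [d dE [cd _ _]]] := Ck_cvg_leq (r1 : (0 < r)%N) (PK i k).
  by exists d => m x x01; split; [exact: dE|exact: cd].
pose dQ m x : 'M[R]_n.+1 := \matrix_(i, k) dP (i, k) m x.
have dQE m (x : R) : 0 <= x <= 1 -> forall i k,
    is_derive x 1 (fun s => Pi (X m s) i k) (dQ m x i k).
  by move=> x01 i k; rewrite mxE; exact: (HdP (i, k) m x x01).1.
have cdQ m (x : R) : 0 <= x <= 1 -> forall i k, {for x, continuous (fun s => dQ m s i k)}.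
  move=> x01 i k; rewrite (_ : (fun s => _) = dP (i, k) m).
    exact: (HdP (i, k) m x x01).2.
  by apply/funext => s; rewrite mxE.
have MK : Ck_cvg r (fun m x => minor j (Pi (X m x))).
  apply: Ck_cvg_det => a c; apply: Ck_cvg_ext (PK (rev_ord (inc a)) (inc c)) => m x.
  by rewrite mxE.
have [S1 [h1 [s1 _ a1 o1 e1]]] := calL_iti_orders j Gw1 (XG None) (dQE None) (cdQ None).
have [t t01|N HN] := global_count MK (sorted_uniq lt_trans ltxx s1) _ o1.
  by have [h1r al] := a1 t t01; split => //; exact: leq_trans h1r _.
have [S0 [h0 [s0 i0 a0 _ e0]]] :=
  calL_iti_orders j (HDelta N).1 (XG (Some N)) (dQE (Some N)) (cdQ (Some N)).
(* Both totals contain twice [mult (eta n) j] for the two ends, and these terms are cancelled. *)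
have := HN [seq (t, h0 t) | t <- S0]; rewrite big_map /= e0 e1 leq_add2r; apply.
split.
- by rewrite -map_comp map_id_in.
- by rewrite all_map.
- move=> _ /mapP[t tS ->] /=; have [h0r [l _ al]] := a0 t (allP i0 _ tS).
  by split; [exact: leq_trans h0r _|exists l].
Qed.
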